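(* Assume that $f$ satisfies the KL inequality with respect to $x^*\in\Omega$ in $B_\delta(x^* )\cap[f(x^* )<f<\eta]$ with desingularizing function $\varphi$. Let $\{x_k\}$ be an infinite sequence generated by the first-order method with SSC applied to $\min\{f(x):x\in\Omega\}$, where the method $\mathcal A$ used in the SSC satisfies: the SSC procedure always terminates in a finite number of steps, and $\mathrm{SB}_{\mathcal A}(\Omega)=\tau>0$. Put $a=\frac L2$, $b=\frac{L(1+\tau)}{\tau}$, $\alpha(t)=\frac b{\sqrt a}\varphi'(t)$, and assume that (i) $f(x^* )\le f(x_0)<\eta$; (ii) for every $k$, $x_k\in B_\delta(x^* )$ implies $f(x_{k+1})\ge f(x^* )$; (iii) $\frac ba\varphi(f(x_0)-f(x^* ))+2\sqrt{\frac{f(x_0)-f(x^* )-\sigma_\alpha(f(x_0)-f(x^* ))}{a}}+\|x_0-x^*\|<\delta$. Then $\{x_k\}$ converges to a stationary point $\tilde x^*$, and for every $k\ge0$ $$f(x_k)-f(x^* )\le\sigma_\alpha^{(k)}(f(x_0)-f(x^* )),$$ $$\|x_k-\tilde x^*\|\le\sum_{i=k}^\infty\|x_i-x_{i+1}\|\le\frac ba\varphi(f(x_k)-f(x^* ))+2\sqrt{\frac{f(x_k)-f(x^* )-\sigma_\alpha(f(x_k)-f(x^* ))}{a}} .$$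
   Context: $\Omega\subset\mathbb R^n$ is nonempty, compact and convex; $f\in C^1(\Omega)$ satisfies $\|\nabla f(x)-\nabla f(y)\|\le L\|x-y\|$ for all $x,y\in\Omega$, with $L>0$. $T_\Omega(x)$ is the tangent cone of $\Omega$ at $x$, $\pi(C,\cdot)$ the Euclidean projection on a closed convex set $C$, $\pi_x(g)=\|\pi(T_\Omega(x),g)\|$, $\hat c=c/\|c\|$ for $c\neq0$ and $\hat 0=0$; $B_R(x)$, $\bar B_R(x)$ are the open and closed Euclidean balls. A point $x\in\Omega$ is stationary if $\pi_x(-\nabla f(x))=0$. KL inequality with respect to $x^*$ in $B_\delta(x^* )\cap[f(x^* )<f<\eta]$ (with $\eta>f(x^* )$): there is a continuous concave $\varphi:[0,\eta-f(x^* ))\to\mathbb R_{\ge0}$ (desingularizing function) with $\varphi(0)=0$, $\varphi$ of class $C^1$ and $\varphi'>0$ on $(0,\eta-f(x^* ))$, such that $\varphi'(f(x)-f(x^* ))\,\|\pi(T_\Omega(x),-\nabla f(x))\|\ge1$ for all $x\in\Omega\cap B_\delta(x^* )$ with $f(x^* )<f(x)<\eta$. (Equivalently, the usual KL inequality for $f+i_\Omega$, with $i_\Omega$ the indicator function.) $\sigma_\alpha(t)=\max\{s\in[0,t]:\ 1/\alpha(s)^2\le t-s\}$ with $\alpha(0)=\lim_{t\to0^+}\alpha(t)\in(0,\infty]$, $1/\infty=0$, $\max(\emptyset)=0$; $\sigma_\alpha^{(k)}$ is $\sigma_\alpha$ applied $k$ times, $\sigma^{(0)}_\alpha(t)=t$.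 Method. A method $\mathcal A$ assigns to each $(x,g)\in\Omega\times\mathbb R^n$ a nonempty set of feasible directions $\mathcal A(x,g)\subset (T_\Omega(x)\cap\{y:\langle g,y\rangle>0\})\cup\{0\}$; $\mathcal A(x,g)=\{0\}$ if $\pi_x(g)=0$, and $0\notin\mathcal A(x,g)$ otherwise. Slope bounds. $\mathrm{DSB}_{\mathcal A}(\Omega,x,g)=\inf_{d\in\mathcal A(x,g)}\frac{\langle g,d\rangle}{\pi_x(g)\|d\|}$ if $\pi_x(g)\ne0$ and $\mathrm{DSB}_{\mathcal A}(\Omega,x,g)=1$ otherwise; $\mathrm{SB}_{\mathcal A}(\Omega)=\inf_{x\in\Omega,\,g\in\mathbb R^n}\mathrm{DSB}_{\mathcal A}(\Omega,x,g)$. SSC procedure SSC$(\bar x,g)$. Set $y_0=\bar x$, $j=0$ and iterate. (I) Choose $d_j\in\mathcal A(y_j,g)$ and a maximal stepsize $\alpha_{\max}^{(j)}$; it is assumed that if $d_j\neq0$ then $\alpha_{\max}^{(j)}>0$ and $y_j+\alpha d_j\in\Omega$ for all $\alpha\in[0,\alpha_{\max}^{(j)}]$. If $d_j=0$, return $y_j$. (II) Let $\Omega_j=\bar B_{\|g\|/(2L)}(\bar x+\frac{g}{2L})\cap\bar B_{\langle g,\hat d_j\rangle/L}(\bar x)$; set $\beta_j=0$ if $y_j\notin\Omega_j$ and $\beta_j=\max\{\beta\ge0: y_j+\beta d_j\in\Omega_j\}$ if $y_j\in\Omega_j$; let $\alpha_j=\min(\alpha_{\max}^{(j)},\beta_j)$.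 If $\alpha_j=0$, return $y_j$. (III) Set $y_{j+1}=y_j+\alpha_jd_j$. If $\alpha_j=\beta_j$, return $y_{j+1}$; otherwise increase $j$ by 1 and repeat from (I). First-order method with SSC. Start from $x_0\in\Omega$; while $x_k$ is not stationary, set $g=-\nabla f(x_k)$, compute $x_{k+1}^{tr}=\mathrm{SSC}(x_k,g)$, and select any $x_{k+1}\in\Omega$ with $f(x_{k+1})\le\min\big(f(x_{k+1}^{tr}),\,f(x_k)-\frac L2\|x_{k+1}-x_k\|^2\big)$. *)

(* Defs.v *)
From HB Require Import structures.
From mathcomp Require Import all_boot all_order all_algebra.
From mathcomp Require Import all_classical all_reals all_analysis.

Set Implicit Arguments.
Unset Strict Implicit.
Unset Printing Implicit Defensive.

Import Order.TTheory GRing.Theory Num.Theory.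
Import numFieldNormedType.Exports.

Local Open Scope classical_set_scope.
Local Open Scope ring_scope.

(* Euclidean structure of R^n.  The norm `|x| that the library puts on
   'rV[R]_n is the sup norm: it induces the same topology, so that compactness,
   closures, convergence and differentiability are the library's, but all
   metric statements below use enorm. *)
Definition dot (R : realType) (n : nat) (u v : 'rV[R]_n) : R :=
  \sum_(i < n) u 0 i * v 0 i.

Definition enorm (R : realType) (n : nat) (u : 'rV[R]_n) : R :=
  Num.sqrt (dot u u).

Definition eball (R : realType) (n : nat) (x : 'rV[R]_n) (r : R) :
    set 'rV[R]_n :=
  [set y | enorm (y - x) < r].

Definition ecball (R : realType) (n : nat) (x : 'rV[R]_n) (r : R) :
    set 'rV[R]_n :=
  [set y | enorm (y - x) <= r].

(* hat 0 = 0 because 0^-1 = 0 *)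
Definition hat (R : realType) (n : nat) (c : 'rV[R]_n) : 'rV[R]_n :=
  (enorm c)^-1 *: c.

Definition gradient (R : realType) (n : nat) (f : 'rV[R]_n -> R)
    (x : 'rV[R]_n) : 'rV[R]_n :=
  \row_(i < n) 'D_(delta_mx 0 i) f x.

(* Only the values of f and of its gradient on Omega matter for the rest of
   the file. *)
Definition C1_on (R : realType) (n : nat) (Omega : set 'rV[R]_n)
    (f : 'rV[R]_n -> R) : Prop :=
  (forall x, Omega x -> differentiable f x) /\
  {within Omega, continuous (gradient f)}.

(* The tangent cone of a convex set: the closure of R_+ (Omega - x). *)
Definition tangent_cone (R : realType) (n : nat) (Omega : set 'rV[R]_n)
    (x : 'rV[R]_n) : set 'rV[R]_n :=
  closure [set v | exists t y, [/\ 0 <= t, Omega y & v = t *: (y - x)]].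

(* The default value 0 is irrelevant when C is nonempty, closed and convex. *)
Definition proj (R : realType) (n : nat) (C : set 'rV[R]_n) (g : 'rV[R]_n) :
    'rV[R]_n :=
  xget 0 [set p | C p /\ forall q, C q -> enorm (g - p) <= enorm (g - q)].

Definition pinorm (R : realType) (n : nat) (Omega : set 'rV[R]_n)
    (x g : 'rV[R]_n) : R :=
  enorm (proj (tangent_cone Omega x) g).

Definition stationary (R : realType) (n : nat) (Omega : set 'rV[R]_n)
    (f : 'rV[R]_n -> R) (x : 'rV[R]_n) : Prop :=
  Omega x /\ pinorm Omega x (- gradient f x) = 0.

(* phi is a total function of which only the values on [0, r) matter. *)
Definition desingularizing (R : realType) (r : R) (phi : R -> R) : Prop :=
  [/\ {within `[0, r[, continuous phi},
      convex_function (`[0, r[%classic : set R) (fun t => - phi t),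
      phi 0 = 0 /\ {in `[0, r[, forall t, 0 <= phi t},
      {in `]0, r[, forall t, derivable phi t 1} /\
      {in `]0, r[, continuous (derive1 phi)} &
      {in `]0, r[, forall t, 0 < derive1 phi t}].

Definition KL_inequality (R : realType) (n : nat) (Omega : set 'rV[R]_n)
    (f : 'rV[R]_n -> R) (xs : 'rV[R]_n) (delta eta : R) (phi : R -> R) : Prop :=
  [/\ 0 < delta, f xs < eta, desingularizing (eta - f xs) phi &
      forall x, Omega x -> eball xs delta x -> f xs < f x < eta ->
        1 <= derive1 phi (f x - f xs) * pinorm Omega x (- gradient f x)].

(* The maximum of a set of reals, and 0 when there is none. *)
Definition max0 (R : realType) (S : set R) : R := xget 0 (S `&` ubound S).

Definition extend0 (R : realType) (alpha : R -> R) (t : R) : \bar R :=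
  if t == 0 then lim ((alpha s)%:E @[s --> 0^'+]) else (alpha t)%:E.

(* In the extended reals (+oo)^-1 = 0. *)
Definition sigma (R : realType) (alpha : R -> R) (t : R) : R :=
  max0 [set s | 0 <= s <= t /\
                ((extend0 alpha s ^+ 2)^-1 <= (t - s)%:E)%E].

Definition is_method (R : realType) (n : nat) (Omega : set 'rV[R]_n)
    (A : 'rV[R]_n -> 'rV[R]_n -> set 'rV[R]_n) : Prop :=
  forall x g, Omega x ->
    [/\ A x g !=set0,
        A x g `<=` (tangent_cone Omega x `&` [set y | 0 < dot g y]) `|` [set 0],
        pinorm Omega x g = 0 -> A x g = [set 0] &
        pinorm Omega x g != 0 -> ~ A x g 0].

(* For a method, the sets whose infimum is taken in DSB and SB are nonempty and
   bounded below by 0, so that inf in R is the true infimum. *)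
Definition DSB (R : realType) (n : nat)
    (A : 'rV[R]_n -> 'rV[R]_n -> set 'rV[R]_n) (Omega : set 'rV[R]_n)
    (x g : 'rV[R]_n) : R :=
  if pinorm Omega x g != 0 then
    inf [set dot g d / (pinorm Omega x g * enorm d) | d in A x g]
  else 1.

Definition SB (R : realType) (n : nat)
    (A : 'rV[R]_n -> 'rV[R]_n -> set 'rV[R]_n) (Omega : set 'rV[R]_n) : R :=
  inf [set r | exists x g, Omega x /\ r = DSB A Omega x g].

(* The SSC procedure on input (xbar, g).  One execution is driven by the stream
   d of the directions d_j and the stream am of the maximal stepsizes
   alpha_max^(j); what these streams contain beyond the last executed iteration
   is irrelevant. *)
Section SSC.
Variables (R : realType) (n : nat) (L : R) (xbar g : 'rV[R]_n).

Definition ssc_region (dj : 'rV[R]_n) : set 'rV[R]_n :=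
  ecball (xbar + (2 * L)^-1 *: g) (enorm g / (2 * L)) `&`
  ecball xbar (dot g (hat dj) / L).

Definition ssc_beta (y dj : 'rV[R]_n) : R :=
  if `[< ssc_region dj y >] then
    max0 [set beta | 0 <= beta /\ ssc_region dj (y + beta *: dj)]
  else 0.

Definition ssc_step (y dj : 'rV[R]_n) (amj : R) : R :=
  Num.min amj (ssc_beta y dj).

Variables (d : nat -> 'rV[R]_n) (am : nat -> R).

Fixpoint ssc_y (j : nat) : 'rV[R]_n :=
  if j is i.+1 then ssc_y i + ssc_step (ssc_y i) (d i) (am i) *: d i
  else xbar.

Definition ssc_alpha (j : nat) : R := ssc_step (ssc_y j) (d j) (am j).

Definition ssc_stops (j : nat) : Prop :=
  [\/ d j = 0, ssc_alpha j = 0 | ssc_alpha j = ssc_beta (ssc_y j) (d j)].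

Definition ssc_reaches (j : nat) : Prop :=
  forall i, (i < j)%N -> ~ ssc_stops i.

Definition ssc_terminates : Prop := exists j, ssc_stops j.

Definition ssc_returns (z : 'rV[R]_n) : Prop :=
  exists j, [/\ ssc_reaches j, ssc_stops j &
    z = if (d j == 0) || (ssc_alpha j == 0) then ssc_y j else ssc_y j.+1].

Definition ssc_admissible (Omega : set 'rV[R]_n)
    (A : 'rV[R]_n -> 'rV[R]_n -> set 'rV[R]_n) : Prop :=
  forall j, ssc_reaches j ->
    A (ssc_y j) g (d j) /\
    (d j != 0 -> 0 < am j /\
       forall a, 0 <= a <= am j -> Omega (ssc_y j + a *: d j)).

End SSC.

(* How the directions and the maximal stepsizes are selected is part of the
   specification of the procedure (without any selection rule the procedure
   could never be said to terminate, as the maximal stepsizes may be taken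
   arbitrarily small).  A selection rule is a set of streams (d, am) for each
   input (xbar, g), which allows for rules that depend on the previous
   iterations of the same execution. *)
Definition ssc_rule (R : realType) (n : nat) : Type :=
  'rV[R]_n -> 'rV[R]_n -> set ((nat -> 'rV[R]_n) * (nat -> R)).

Definition is_ssc_rule (R : realType) (n : nat) (L : R)
    (Omega : set 'rV[R]_n) (A : 'rV[R]_n -> 'rV[R]_n -> set 'rV[R]_n)
    (rule : ssc_rule R n) : Prop :=
  forall xbar g c, Omega xbar -> rule xbar g c ->
    ssc_admissible L xbar g c.1 c.2 Omega A.

Definition ssc_always_terminates (R : realType) (n : nat) (L : R)
    (Omega : set 'rV[R]_n) (rule : ssc_rule R n) : Prop :=
  forall xbar g c, Omega xbar -> rule xbar g c ->
    ssc_terminates L xbar g c.1 c.2.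

(* z is a possible value of SSC(xbar, g) *)
Definition SSC (R : realType) (n : nat) (L : R) (rule : ssc_rule R n)
    (xbar g z : 'rV[R]_n) : Prop :=
  exists2 c, rule xbar g c & ssc_returns L xbar g c.1 c.2 z.

(* The sequence is infinite: the stopping test never succeeds. *)
Definition generated_by_ssc (R : realType) (n : nat) (L : R)
    (Omega : set 'rV[R]_n) (f : 'rV[R]_n -> R) (rule : ssc_rule R n)
    (x : nat -> 'rV[R]_n) : Prop :=
  Omega (x 0%N) /\
  forall k, [/\ ~ stationary Omega f (x k), Omega (x k.+1) &
    exists2 z, SSC L rule (x k) (- gradient f (x k)) z &
      f (x k.+1) <=
        Num.min (f z) (f (x k) - L / 2 * enorm (x k.+1 - x k) ^+ 2)].

(* Main.v *)
Require Import Defs.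
From mathcomp Require Import all_boot all_order all_algebra.
From mathcomp Require Import all_classical all_reals all_analysis.
From mathcomp Require Import ring lra.
Import Order.TTheory GRing.Theory Num.Theory.
Import numFieldNormedType.Exports.
Set Implicit Arguments.
Unset Strict Implicit.
Unset Printing Implicit Defensive.
Local Open Scope classical_set_scope.
Local Open Scope ring_scope.

(** Write [r k = f (x k) - f xs], [a = L / 2] and [b = L (1 + tau) / tau].

    One execution of the SSC procedure from [xb = x k] moves along a polygonal
    line which stays in the ball having [xb] and [xb + g / L] as endpoints of a
    diameter; on this ball the descent lemma gives
    [f y <= f xb - a |y - xb|^2].  Each segment also stays so close to [xb] that
    the slope of [f] in its direction, which is negative at [xb], is still
    nonpositive on it, so [f] decreases along the line.  If the output
    [z] is on the boundary of one of the two balls, then a vertex [y] on the way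
    had a slope at most [L |z - xb|]; otherwise the line stops at a vertex
    [y = z] with such a slope or with no ascent direction for [g].  In all cases
    the slope bound of the method gives
    [pinorm y (- grad f y) <= b |z - xb|]: this is [ssc_estimate].

    If [y] lies where the KL inequality holds, the inequality at [y], moved by
    concavity of [phi] to the lower value [r k.+1], reads
    [1 <= alpha (r k.+1)^2 (r k - r k.+1)], that is [r k.+1 <= sigma (r k)]
    ([KL_le_sigma]).  So everything depends on staying in the KL ball, and this
    is what the function
    [P r = (b / a) phi (sigma r) + 2 sqrt ((r - sigma r) / a)] measures.  When
    [r' <= sigma r], concavity of [phi] and [alpha (sigma r)^2 (r - sigma r) >= 1]
    yield [sqrt ((r - r') / a) <= P r - P r'] ([potential_step]).  Both the
    length of the step from [x k] to [x k.+1] and the distance from [x k] to the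
    vertex [y] are bounded by such square roots; hence [|x k - xs| + P (r k)]
    never increases, starts below [delta] by the third assumption, and keeps
    both the iterates and the vertices in the ball.

    The steps are then dominated by a telescoping sum, so the sequence converges
    and its tails have length at most [P (r k)].  The vertices [y] have the same
    limit and their projected gradients tend to 0, which makes the limit
    stationary ([stationary_limit]). *)

(** * Euclidean geometry of row vectors *)

Section Euclid.
Context {R : realType} {n : nat}.
Implicit Types (u v w : 'rV[R]_n) (c : R).

Lemma dotC u v : dot u v = dot v u.
Proof. by apply: eq_bigr => i _; rewrite mulrC. Qed.

Lemma dotDl u v w : dot (u + v) w = dot u w + dot v w.
Proof. by rewrite -big_split; apply: eq_bigr => i _; rewrite mxE mulrDl. Qed.

Lemma dotZl c u w : dot (c *: u) w = c * dot u w.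
Proof. by rewrite /dot mulr_sumr; apply: eq_bigr => i _; rewrite mxE mulrA. Qed.

Lemma dotNl u w : dot (- u) w = - dot u w.
Proof. by rewrite -scaleN1r dotZl mulN1r. Qed.

Lemma dotBl u v w : dot (u - v) w = dot u w - dot v w.
Proof. by rewrite dotDl dotNl. Qed.

Lemma dotDr u v w : dot u (v + w) = dot u v + dot u w.
Proof. by rewrite dotC dotDl !(dotC u). Qed.

Lemma dotZr c u w : dot u (c *: w) = c * dot u w.
Proof. by rewrite dotC dotZl dotC. Qed.

Lemma dotNr u w : dot u (- w) = - dot u w.
Proof. by rewrite dotC dotNl dotC. Qed.

Lemma dotBr u v w : dot u (v - w) = dot u v - dot u w.
Proof. by rewrite dotDr dotNr. Qed.

Lemma dot0l u : dot 0 u = 0.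
Proof. by rewrite -(scale0r 0) dotZl mul0r. Qed.

Lemma dot0r u : dot u 0 = 0.
Proof. by rewrite dotC dot0l. Qed.

Lemma dot_ge0 u : 0 <= dot u u.
Proof. by apply: sumr_ge0 => i _; rewrite -expr2 sqr_ge0. Qed.

Lemma enorm_ge0 u : 0 <= enorm u.
Proof. exact: sqrtr_ge0. Qed.

Lemma sqr_enorm u : enorm u ^+ 2 = dot u u.
Proof. by rewrite sqr_sqrtr// dot_ge0. Qed.

Lemma enorm0 : enorm (0 : 'rV[R]_n) = 0.
Proof. by rewrite /enorm dot0l sqrtr0. Qed.

Lemma enorm_eq0 u : enorm u = 0 -> u = 0.
Proof.
move=> u0; have := sqr_enorm u; rewrite u0 expr0n /= => /esym/eqP.
rewrite psumr_eq0; last by move=> i _; rewrite -expr2 sqr_ge0.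
move=> /allP u0'; apply/rowP => i; rewrite mxE.
by have /u0' := mem_index_enum i; rewrite mulf_eq0 orbb => /eqP.
Qed.

Lemma enorm_gt0 u : u != 0 -> 0 < enorm u.
Proof.
move=> u0; rewrite lt_neqAle enorm_ge0 andbT eq_sym.
by apply: contra_neq u0 => /enorm_eq0.
Qed.

Lemma enormZ c u : enorm (c *: u) = `|c| * enorm u.
Proof.
by rewrite /enorm dotZl dotZr mulrA -expr2 sqrtrM ?sqr_ge0// sqrtr_sqr.
Qed.

Lemma enormN u : enorm (- u) = enorm u.
Proof. by rewrite -scaleN1r enormZ normrN1 mul1r. Qed.

Lemma enormBC u v : enorm (u - v) = enorm (v - u).
Proof. by rewrite -enormN opprB. Qed.

(** Cauchy-Schwarz, from the nonnegativity of the squared norm of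
    [|v|^2 u - <u, v> v]. *)
Lemma dot_le_enorm u v : dot u v <= enorm u * enorm v.
Proof.
have [->|v0] := eqVneq v 0; first by rewrite dot0r enorm0 mulr0.
have ev := enorm_gt0 v0.
have := dot_ge0 ((enorm v) ^+ 2 *: u - dot u v *: v).
rewrite dotBl !dotBr !dotZl !dotZr -!sqr_enorm (dotC v u).
move: (dot u v) (enorm u) (enorm v) (enorm_ge0 u) ev => d p q p0 q0 h.
rewrite (le_trans (ler_norm _))// -(@ger0_norm _ (p * q)) ?mulr_ge0 ?(ltW q0)//.
rewrite -ler_sqr ?nnegrE ?normr_ge0// !real_normK ?num_real//.
rewrite -(ler_pM2l (exprn_gt0 2 q0)) -subr_ge0; apply: le_trans h _.
by rewrite le_eqVlt; apply/orP; left; apply/eqP; ring.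
Qed.

Lemma enormD u v : enorm (u + v) <= enorm u + enorm v.
Proof.
rewrite -ler_sqr ?nnegrE ?addr_ge0 ?enorm_ge0//.
rewrite sqr_enorm dotDl !dotDr (dotC v u) -!sqr_enorm.
by have := dot_le_enorm u v; nra.
Qed.

Lemma enormB u v : enorm (u - v) <= enorm u + enorm v.
Proof. by rewrite -(enormN v) enormD. Qed.

Lemma enorm_triangle u v w : enorm (u - w) <= enorm (u - v) + enorm (v - w).
Proof. by rewrite (le_trans _ (enormD _ _))// subrKA. Qed.

Lemma enorm_sum (m k : nat) (x : nat -> 'rV[R]_n) : (m <= k)%N ->
  enorm (x m - x k) <= \sum_(m <= i < k) enorm (x i - x i.+1).
Proof.
elim: k => [|k IH]; first by rewrite leqn0 => /eqP ->; rewrite big_geq// subrr enorm0.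
rewrite leq_eqVlt => /orP[/eqP ->|]; first by rewrite big_geq// subrr enorm0.
rewrite ltnS => mk; rewrite big_nat_recr//=.
by rewrite (le_trans (enorm_triangle _ (x k) _))// lerD2r IH.
Qed.

(** Through this comparison with the library's sup norm, Euclidean estimates
    yield boundedness, Cauchy sequences and limits in the library's sense. *)
Lemma norm_le_enorm u : `|u| <= enorm u.
Proof.
rewrite [leLHS]/Num.norm /= mx_normrE; apply/bigmax_leP; split; first exact: enorm_ge0.
move=> [i j] _ /=; rewrite (ord1 i).
rewrite -sqrtr_sqr ler_wsqrtr// /dot (bigD1 j)//= expr2 lerDl.
by apply: sumr_ge0 => k _; rewrite -expr2 sqr_ge0.
Qed.

Lemma dot_cvg {T : Type} (F : set_system T) {FF : Filter F} (g h : T -> 'rV[R]_n)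
    (u v : 'rV[R]_n) :
  g x @[x --> F] --> u -> h x @[x --> F] --> v ->
  dot (g x) (h x) @[x --> F] --> dot u v.
Proof.
move=> gu hv; rewrite /dot; apply: (cvg_big (@add_continuous R)) => i _; apply: cvgM.
  exact: (continuous_cvg _ (h := fun w : 'rV[R]_n => w 0 i)
    (@coord_continuous R 1 n 0 i u) gu).
exact: (continuous_cvg _ (h := fun w : 'rV[R]_n => w 0 i)
  (@coord_continuous R 1 n 0 i v) hv).
Qed.

Lemma enorm_cvg {T : Type} (F : set_system T) {FF : Filter F} (g : T -> 'rV[R]_n)
    (u : 'rV[R]_n) :
  g x @[x --> F] --> u -> enorm (g x) @[x --> F] --> enorm u.
Proof.
move=> gu.
rewrite /enorm; exact: (continuous_cvg _ (h := Num.sqrt) (@sqrt_continuous R _)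
  (dot_cvg gu gu)).
Qed.

Lemma enorm0_cvg {T : Type} (F : set_system T) {FF : Filter F}
    (g : T -> 'rV[R]_n) (u : 'rV[R]_n) :
  enorm (g x - u) @[x --> F] --> (0 : R) -> g x @[x --> F] --> u.
Proof.
move=> /cvgrPdist_lt gu; apply/cvgrPdist_lt => e e0.
near=> x; rewrite distrC (le_lt_trans (norm_le_enorm _))//.
have : `|0 - enorm (g x - u)| < e by near: x; exact: gu.
by rewrite sub0r normrN ger0_norm ?enorm_ge0.
Unshelve. all: by end_near. Qed.

End Euclid.

(** * Projection onto the tangent cone *)

Section Projection.
Context {R : realType} {n : nat}.
Implicit Types (g x y v p : 'rV[R]_n) (Omega C : set 'rV[R]_n).

(** Only the points of [C] that are not farther from [g] than some given point
    of [C] compete for the minimum, and they form a compact set. *)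
Lemma proj_exists C g : closed C -> C !=set0 ->
  C (Defs.proj C g) /\ (forall q, C q -> enorm (g - Defs.proj C g) <= enorm (g - q)).
Proof.
move=> cC [c0 Cc0].
suff: exists p, [set p | C p /\ forall q, C q -> enorm (g - p) <= enorm (g - q)] p.
  by move=> /(xgetPex (0 : 'rV[R]_n)).
pose D := C `&` [set p | enorm (g - p) <= enorm (g - c0)].
have contf : continuous (fun p => enorm (g - p)).
  move=> p; apply: (enorm_cvg (F := nbhs p) (g := fun p => g - p)).
  by apply: cvgB; [exact: cvg_cst|exact: cvg_id].
have cD : compact D.
  apply: bounded_closed_compact; last first.
    apply: closedI => //.
    by apply: (@preimage_closed _ _ (fun p => enorm (g - p)) [set r | r <= _]);
      [move=> p _; exact: contf|exact: closed_le].
  exists (`|g| + enorm (g - c0)); split; first exact: num_real.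
  move=> M hM p [_ /= hp]; apply: le_trans (ltW hM).
  rewrite -[p](subKr g) (le_trans (ler_normB _ _))// lerD2l.
  exact: le_trans (norm_le_enorm _) hp.
have [|p pD pmin] := compact_EVT_min _ cD (continuous_subspaceT contf).
  by exists c0; split => //=.
move: pD; rewrite inE => -[Cp hp].
exists p; split => // q Cq.
have [hq|/ltW hq] := leP (enorm (g - q)) (enorm (g - c0)).
  by apply: pmin; rewrite inE.
exact: le_trans hq.
Qed.

Section Cone.
Variables (T : set 'rV[R]_n).
Hypotheses (T0 : T 0) (closedT : closed T).
Hypothesis TD : forall u v, T u -> T v -> T (u + v).
Hypothesis TZ : forall (t : R) v, 0 <= t -> T v -> T (t *: v).

(** Moreau's characterization of the projection [p], from the first variation
    of the distance to [g] along [p + e v] with [e > 0].  The ray through [p]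
    can be followed in both directions from [p], hence the equality. *)
Lemma proj_coneP g : [/\ T (Defs.proj T g),
  dot (g - Defs.proj T g) (Defs.proj T g) = 0 &
  forall v, T v -> dot (g - Defs.proj T g) v <= 0].
Proof.
have [|Tp pmin] := @proj_exists T g closedT; first by exists 0.
set p := Defs.proj T g in Tp pmin *; set w := g - p.
have {}pmin v : T (p + v) -> dot w w <= dot (w - v) (w - v).
  move=> /pmin; rewrite opprD addrA.
  by rewrite -ler_sqr ?nnegrE ?enorm_ge0// !sqr_enorm.
clearbody w.
have var v : (forall e : R, 0 < e -> e <= 1 -> T (p + e *: v)) -> dot w v <= 0.
  move=> Tv; rewrite leNgt; apply/negP => d0.
  set d := dot _ _ in d0.
  pose e := Num.min 1 (d / (dot v v + 1)).
  have vv : 0 < dot v v + 1 by have := dot_ge0 v; lra.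
  have e0 : 0 < e by rewrite /e lt_min ltr01 divr_gt0.
  have e1 : e <= 1 by rewrite /e ge_min lexx.
  have ed : e * (dot v v + 1) <= d by rewrite -ler_pdivlMr// /e ge_min lexx orbT.
  have := pmin _ (Tv _ e0 e1).
  rewrite [leRHS]dotBl !dotBr !dotZl !dotZr (dotC v w) -/d => h.
  have := dot_ge0 v; nra.
split => //; last first.
  by move=> v Tv; apply: var => e e0 _; apply: TD => //; apply: TZ => //; exact: ltW.
apply/eqP; rewrite eq_le; apply/andP; split.
  by apply: var => e e0 _; apply: TD => //; apply: TZ => //; exact: ltW.
rewrite -oppr_le0 -dotNr; apply: var => e e0 e1.
by rewrite scalerN -{1}[p]scale1r -scalerBl; apply: TZ => //; rewrite subr_ge0.
Qed.

End Cone.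

Section Tangent.
Variables (Omega : set 'rV[R]_n) (x : 'rV[R]_n).
Hypotheses (cvxO : convex_set Omega) (Ox : Omega x).

Lemma convex_setP y z (t : R) : Omega y -> Omega z -> 0 <= t <= 1 ->
  Omega (y + t *: (z - y)).
Proof.
move=> Oy Oz t01.
have := @cvxO z y (Itv01 (andP t01).1 (andP t01).2).
rewrite !inE => /(_ Oz Oy); congr (Omega _).
rewrite /conv /= /unstable.onem scalerBl scale1r scalerBr.
by rewrite addrCA addrA addrC addrA.
Qed.

(** The tangent cone is by definition the closure of [K]. *)
Let K := [set v | exists t y, [/\ 0 <= t, Omega y & v = t *: (y - x)]].

Let K_closedD u v : K u -> K v -> K (u + v).
Proof.
move=> [s [y [s0 Oy ->]]] [t [z [t0 Oz ->]]].
have [st0|st0] := eqVneq (s + t) 0.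
  have [-> ->] : s = 0 /\ t = 0 by split; lra.
  by exists 0, x; rewrite !scale0r addr0; split.
have stp : 0 < s + t by rewrite lt_neqAle eq_sym st0 addr_ge0.
exists (s + t), (y + (t / (s + t)) *: (z - y)); split; first exact: ltW.
  apply: convex_setP => //; rewrite divr_ge0 ?(ltW stp)//=.
  by rewrite ler_pdivrMr// mul1r lerDr.
by apply/rowP => i; rewrite !mxE; field.
Qed.

Lemma tangent_cone_sub y : Omega y -> tangent_cone Omega x (y - x).
Proof.
by move=> Oy; apply: subset_closure; exists 1, y; rewrite scale1r; split.
Qed.

Let T0 : tangent_cone Omega x 0.
Proof. by rewrite -(subrr x); exact: tangent_cone_sub. Qed.

Let TD u v : tangent_cone Omega x u -> tangent_cone Omega x v ->
  tangent_cone Omega x (u + v).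
Proof.
move=> Tu Tv B /(@add_continuous _ (u, v))[[B1 B2]/= [nB1 nB2] sB].
have [u' [Ku' Bu']] := Tu _ nB1; have [v' [Kv' Bv']] := Tv _ nB2.
by exists (u' + v'); split; [exact: K_closedD|exact: (sB (u', v'))].
Qed.

Let TZ (t : R) v : 0 <= t -> tangent_cone Omega x v ->
  tangent_cone Omega x (t *: v).
Proof.
move=> t0 Tv B nB.
have nB' : nbhs v ((fun w => t *: w) @^-1` B) by exact: (@scaler_continuous _ _ t v).
have [_ [[s [y [s0 Oy ->]]] Bv']] := Tv _ nB'.
exists (t *: (s *: (y - x))); split => //.
by exists (t * s), y; rewrite scalerA mulr_ge0.
Qed.

Let coneP g := proj_coneP T0 (@closed_closure _ K) TD TZ g.

(** The vectors [y - x] lie in the tangent cone, on which [g] is dominated by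
    its projection. *)
Lemma dot_le_pinorm g y : Omega y ->
  dot g (y - x) <= pinorm Omega x g * enorm (y - x).
Proof.
move=> Oy; have [_ _ /(_ _ (tangent_cone_sub Oy))] := coneP g.
rewrite dotBl subr_le0 => /le_trans; apply; exact: dot_le_enorm.
Qed.

(** By orthogonality [|p|^2 = <g, p>] for [p] the projection of [g], and [h] is
    dominated by its own projection along [p]. *)
Lemma pinorm_lip g h : pinorm Omega x g <= pinorm Omega x h + enorm (g - h).
Proof.
rewrite /pinorm; have [Tp /eqP pg _] := coneP g.
have [_ _ /(_ _ Tp)] := coneP h.
set p := Defs.proj _ g in Tp pg *; set q := Defs.proj _ h.
move: pg; rewrite !dotBl subr_eq0 -sqr_enorm => /eqP pg.
rewrite subr_le0 => hp.
have := enorm_ge0 p; rewrite le_eqVlt => /orP[/eqP <-|p0].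
  by rewrite addr_ge0 ?enorm_ge0.
rewrite -(ler_pM2r p0) -expr2 -pg mulrDl -[g](subrK h) dotDl addrC.
rewrite lerD// ?subrK; last exact: dot_le_enorm.
by apply: le_trans hp _; exact: dot_le_enorm.
Qed.

Lemma pinorm_ge0 g : 0 <= pinorm Omega x g.
Proof. exact: enorm_ge0. Qed.

Lemma pinorm_eq0 g : (forall y, Omega y -> dot g (y - x) <= 0) ->
  pinorm Omega x g = 0.
Proof.
move=> gle0; have [Tp /eqP pg _] := coneP g.
have gT v : tangent_cone Omega x v -> dot g v <= 0.
  move=> Tv; have clD : closed [set v | dot g v <= 0].
    apply: (@preimage_closed _ _ (fun v => dot g v) [set r | r <= 0]).
      move=> w _; apply: (dot_cvg (F := nbhs w) (g := fun=> g) (h := id)).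
        exact: cvg_cst.
      exact: cvg_id.
    exact: closed_le.
  apply: clD; move: v Tv; apply: closure_subset => _ [t [y [t0 Oy ->]]] /=.
  by rewrite dotZr mulr_ge0_le0// gle0.
apply/eqP; rewrite eq_le pinorm_ge0 andbT -(@ler_pXn2r _ 2) ?nnegrE ?pinorm_ge0//.
move: pg; rewrite dotBl subr_eq0 -sqr_enorm => /eqP pg.
by rewrite /pinorm -pg expr0n /= gT.
Qed.

End Tangent.
End Projection.

(** * Slopes along segments *)

Section Segment.
Context {R : realType} {n : nat}.
Implicit Types (f : 'rV[R]_n -> R) (x y v : 'rV[R]_n) (Omega : set 'rV[R]_n).

Lemma derive_gradient f x v : differentiable f x ->
  'D_v f x = dot (gradient f x) v.
Proof.
move=> df; rewrite deriveE// {1}(row_sum_delta v) linear_sum.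
apply: eq_bigr => i _; rewrite linearZ /= mxE.
by rewrite -deriveE// mulrC.
Qed.

Lemma is_derive_line f x v (t : R) : differentiable f (x + t *: v) ->
  is_derive t 1 (fun s => f (x + s *: v)) (dot (gradient f (x + t *: v)) v).
Proof.
move=> df; rewrite -derive_gradient//.
have E : (fun h : R => h^-1 *: (f (x + (h *: 1 + t) *: v) - f (x + t *: v))) =
         (fun h => h^-1 *: ((f \o shift (x + t *: v)) (h *: v) - f (x + t *: v))).
  apply/funext => h /=; congr (_ *: (f _ - _)).
  by rewrite [h *: 1]mulr1 scalerDl addrCA.
by split; [rewrite /derivable /= E; exact: diff_derivable
          |rewrite /derive /= E].
Qed.

(** The integral of an affine bound on the slope.  Two cases are used: with
    [m = k = 0] the function decreases along the segment, and with [k] equal to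
    [L |v|^2] this is the descent lemma. *)
Lemma segment_bound f x v (m k : R) :
  (forall t : R, 0 <= t <= 1 -> differentiable f (x + t *: v)) ->
  (forall t : R, 0 <= t <= 1 -> dot (gradient f (x + t *: v)) v <= m + k * t) ->
  f (x + v) <= f x + m + k / 2.
Proof.
move=> df dle.
pose F t := f (x + t *: v) - (m * t + k / 2 * t ^+ 2).
have dF (t : R) : 0 <= t <= 1 ->
    is_derive t 1 F (dot (gradient f (x + t *: v)) v - (m + k * t)).
  move=> t01; have := is_derive_line (df _ t01) => d1.
  apply: is_deriveB; apply: is_derive_eq.
  by rewrite /GRing.scale /=; field.
have : F 1 <= F 0.
  apply: (@ler0_derive1_le_cc _ F 0 1) => //.
  - move=> t; rewrite in_itv /= => /andP[t0 t1].
    have t01 : 0 <= t <= 1 by rewrite !ltW.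
    by have [] := dF t t01.
  - move=> t; rewrite in_itv /= => /andP[t0 t1].
    have t01 : 0 <= t <= 1 by rewrite !ltW.
    have := dF t t01 => d1; rewrite derive1E derive_val subr_le0; exact: dle.
  - apply: derivable_within_continuous => t; rewrite in_itv /= => t01.
    by have [] := dF t t01.
  - by rewrite in_itv /= lexx ler01.
  - by rewrite in_itv /= lexx ler01.
rewrite /F scale1r scale0r addr0; lra.
Qed.

Section Smooth.
Variables (Omega : set 'rV[R]_n) (f : 'rV[R]_n -> R) (L : R).
Hypotheses (cvxO : convex_set Omega) (L0 : 0 < L).
Hypothesis df : forall x, Omega x -> differentiable f x.
Hypothesis lip : forall x y, Omega x -> Omega y ->
  enorm (gradient f x - gradient f y) <= L * enorm (x - y).

Lemma descent_lemma x y : Omega x -> Omega y ->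
  f y <= f x + dot (gradient f x) (y - x) + L / 2 * enorm (y - x) ^+ 2.
Proof.
move=> Ox Oy.
have seg (t : R) : 0 <= t <= 1 -> Omega (x + t *: (y - x)) by exact: convex_setP.
have := @segment_bound f x (y - x) (dot (gradient f x) (y - x))
   (L * enorm (y - x) ^+ 2) (fun t t01 => df (seg t t01)).
rewrite addrCA subrr addr0 mulrAC; apply => t t01.
rewrite -lerBlDl -dotBl (le_trans (dot_le_enorm _ _))//.
have := ler_wpM2r (enorm_ge0 (y - x)) (lip (seg t t01) Ox).
rewrite [x + _ - x]addrAC subrr add0r enormZ (ger0_norm (andP t01).1); lra.
Qed.

(** The slope along [v] is [- dot g v] at [xb], and it varies by at most
    [L |v|] times the distance to [xb]: it keeps its sign as long as this
    distance is at most [dot g v / (L |v|)], the radius of the second ball of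
    the SSC region. *)
Lemma decrease_along g xb y v (t : R) : Omega xb -> g = - gradient f xb ->
  0 <= t ->
  (forall s : R, 0 <= s <= 1 -> Omega (y + s *: (t *: v)) /\
     L * enorm (y + s *: (t *: v) - xb) * enorm v <= dot g v) ->
  f (y + t *: v) <= f y.
Proof.
move=> Oxb gE t0 seg.
have := @segment_bound f y (t *: v) 0 0 (fun s s01 => df (seg s s01).1).
rewrite mul0r !addr0; apply => s s01; rewrite mul0r addr0 dotZr.
rewrite mulr_ge0_le0//; have [Os hs] := seg s s01.
rewrite -[gradient f _](subrK (gradient f xb)) dotDl.
have := dot_le_enorm (gradient f (y + s *: (t *: v)) - gradient f xb) v.
have : dot (gradient f xb) v = - dot g v by rewrite gE dotNl opprK.
have := ler_wpM2r (enorm_ge0 v) (lip Os Oxb).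
lra.
Qed.

End Smooth.
End Segment.

(** * Desingularizing functions *)

Section Desingularizing.
Context {R : realType}.
Variables (rho : R) (phi : R -> R).
Hypothesis desing : desingularizing rho phi.

(** Concavity makes the difference quotients at [s] in the direction [u - s]
    at least [phi u - phi s]; then the step size tends to 0 from the right. *)
Lemma desing_tangent (s u : R) : 0 < s < rho -> 0 <= u < rho ->
  derive1 phi s * (s - u) <= phi s - phi u.
Proof.
move=> srho urho; have [_ cvx _ [dphi _] _] := desing.
have ds : derivable phi s 1 by apply: dphi; rewrite in_itv.
have diffs : differentiable phi s by exact/derivable1_diffP.
have Dus : 'D_(u - s) phi s = (u - s) * derive1 phi s.
  rewrite derive1E !deriveE// -{1}[u - s]mulr1.
  by rewrite -[_ * 1]/(_ *: 1) linearZ.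
suff : phi u - phi s <= 'D_(u - s) phi s by rewrite Dus; lra.
have cv := @diff_derivable _ _ _ phi s (u - s) diffs.
have cv' := cvg_dnbhs_at_right cv.
apply: (cvgr_to_ge cv'); near=> h.
have h0 : 0 < h by [].
have h1 : h < 1 by near: h; exact: nbhs_right_lt.
rewrite /= -[_ *: (_ - _)]/(_ * _) ler_pdivlMl// mulrBr lerBrDr.
have h01 : (0 <= h <= 1)%R by rewrite !ltW.
have := cvx (Itv01 (ltW h0) (ltW h1)) u s.
rewrite !inE /= !in_itv /= => /(_ urho).
rewrite (ltW (andP srho).1) (andP srho).2 => /(_ isT).
rewrite /conv /= /conv /= /unstable.onem.
rewrite -![_ *: (- _)]/(_ * _) -![_ *: (_ : R^o)]/(_ * _).
have -> : h * u + (1 - h) * s = h * (u - s) + s by ring.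
lra.
Unshelve. all: by end_near. Qed.

Lemma desing_derive_gt0 (s : R) : 0 < s < rho -> 0 < derive1 phi s.
Proof. by move=> srho; have [_ _ _ _ ->] := desing; rewrite ?in_itv. Qed.

Lemma desing_derive_nincr (s u : R) : 0 < s -> s <= u -> u < rho ->
  derive1 phi u <= derive1 phi s.
Proof.
move=> s0; rewrite le_eqVlt => /orP[/eqP ->//|su] urho.
have srho := lt_trans su urho; have u0 := lt_trans s0 su.
have h1 : derive1 phi s * (s - u) <= phi s - phi u.
  by apply: desing_tangent; [rewrite s0|rewrite (ltW u0)].
have h2 : derive1 phi u * (u - s) <= phi u - phi s.
  by apply: desing_tangent; [rewrite u0|rewrite (ltW s0)].
rewrite -(@ler_pM2r _ (u - s)) ?subr_gt0//; lra.
Qed.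

Lemma desing_ndecr (s u : R) : 0 <= s -> s <= u -> u < rho -> phi s <= phi u.
Proof.
move=> s0; rewrite le_eqVlt => /orP[/eqP ->//|su] urho.
have srho := lt_trans su urho; have u0 := le_lt_trans s0 su.
have u0r : 0 < u < rho by rewrite u0.
have := @desing_tangent u s u0r; rewrite s0 srho => /(_ isT).
have := mulr_gt0 (desing_derive_gt0 u0r) (_ : 0 < u - s); rewrite subr_gt0.
by move=> /(_ su); lra.
Qed.

Lemma desing_ge0 (s : R) : 0 <= s < rho -> 0 <= phi s.
Proof. by move=> srho; have [_ _ [_ ->]] := desing; rewrite ?in_itv. Qed.

End Desingularizing.

(** * The function sigma *)

Section Sigma.
Context {R : realType}.
Variables (rho : R) (alpha : R -> R).
Hypothesis alpha_gt0 : forall s, 0 < s < rho -> 0 < alpha s.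
Hypothesis alpha_cont : forall s, 0 < s < rho -> {for s, continuous alpha}.
Implicit Types s t : R.

Let S t := [set s | 0 <= s <= t /\
                ((extend0 alpha s ^+ 2)^-1 <= (t - s)%:E)%E].

(** Away from 0 the inequality between extended reals is one between reals. *)
Let S_pos s t : 0 < s -> s <= t -> t < rho ->
  S t s <-> 1 <= alpha s ^+ 2 * (t - s).
Proof.
move=> s0 st trho; rewrite /S /= (ltW s0) st /extend0 gt_eqF//.
have a0 : 0 < alpha s by rewrite alpha_gt0// s0 (le_lt_trans st).
rewrite -EFinM inver gt_eqF ?mulr_gt0// lee_fin -expr2.
by rewrite -[X in X <= _]mulr1 ler_pdivrMl ?exprn_gt0//; split=> [[]|].
Qed.

Let sigmaE t : sigma alpha t = xget 0 (S t `&` ubound (S t)).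
Proof. by []. Qed.

Lemma sigma_bounds t : 0 <= t -> 0 <= sigma alpha t <= t.
Proof.
by move=> t0; rewrite sigmaE; case: xgetP => [s _ [[]]|_]; rewrite ?lexx.
Qed.

Lemma sigma_spec t : t < rho -> 0 < sigma alpha t ->
  1 <= alpha (sigma alpha t) ^+ 2 * (t - sigma alpha t).
Proof.
move=> trho; rewrite sigmaE; case: xgetP => [s _ [Ss _]|_]; last by rewrite ltxx.
by move=> s0; apply/S_pos => //; have [/andP[]] := Ss.
Qed.

(** The definition of [sigma] takes the maximum of a set when it exists.  It does
    exist as soon as this set has a positive element [s], since then its
    supremum is positive and [alpha] is continuous there. *)
Lemma le_sigma s t : 0 < s -> s <= t -> t < rho ->
  1 <= alpha s ^+ 2 * (t - s) -> s <= sigma alpha t.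
Proof.
move=> s0 st trho hs.
have Ss : S t s by apply/S_pos.
have supS : has_sup (S t) by split; [exists s | exists t => r [/andP[]]].
pose u := sup (S t).
have ubS : ubound (S t) u by exact: sup_upper_bound.
have su : s <= u by exact: ubS.
have u0 := lt_le_trans s0 su.
have ut : u <= t by apply: ge_sup; [exists s | move=> r [/andP[]]].
have Su : S t u.
  apply/S_pos => //; rewrite leNgt; apply/negP => lt1.
  have hcont : {for u, continuous (fun r => alpha r ^+ 2 * (t - r))}.
    have ac : {for u, continuous alpha}.
      by apply: alpha_cont; rewrite u0 (le_lt_trans ut).
    apply: continuousM; first exact: (continuousM ac ac).
    by apply: continuousB; [exact: cst_continuous|exact: cvg_id].
  have [e /= e0 he] := cvgr_lt _ hcont _ lt1.
  have [|r Sr] := @sup_adherent _ (S t) (Num.min e u) _ supS.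
    by rewrite lt_min e0 u0.
  rewrite -/u => ur; have ru : r <= u by exact: ubS.
  have [ue uu] : u - e < r /\ 0 < r.
    by move: ur; rewrite /Num.min; case: ifP => eu; lra.
  have : alpha r ^+ 2 * (t - r) < 1.
    by apply: he; rewrite /= ger0_norm ?subr_ge0//; lra.
  by apply/negP; rewrite -leNgt; apply/S_pos => //; exact: le_trans ut.
rewrite sigmaE; have := @xgetPex _ 0 (S t `&` ubound (S t)).
by case; [exists u | move=> _ /(_ s Ss)].
Qed.

Lemma sigma_homo s t : 0 <= s -> s <= t -> t < rho ->
  sigma alpha s <= sigma alpha t.
Proof.
move=> s0 st trho; have /andP[ss0 sss] := sigma_bounds s0.
have /andP[tt0 _] := sigma_bounds (le_trans s0 st).
move: ss0; rewrite le_eqVlt => /orP[/eqP <-//|ss0].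
apply: le_sigma => //; first exact: le_trans st.
apply: (le_trans (sigma_spec (le_lt_trans st trho) ss0)).
by rewrite ler_wpM2l ?sqr_ge0// lerD2r.
Qed.

Lemma iter_sigma_bounds k t : 0 <= t -> 0 <= iter k (sigma alpha) t <= t.
Proof.
move=> t0; elim: k => [|k /andP[it0 itt]]; first by rewrite t0 lexx.
have /andP[h0 hle] := sigma_bounds it0.
by rewrite iterS h0 (le_trans hle).
Qed.

End Sigma.

Section Max0.
Context {R : realType}.

(** [max0] takes its default value 0 only on sets without maximum, and a
    closed set contains its supremum. *)
Lemma max0P (S : set R) : S !=set0 -> has_ubound S -> closed S ->
  S (max0 S) /\ ubound S (max0 S).
Proof.
move=> S0 ubS cS; have supS : has_sup S by [].
have Ssup : S (sup S).
  apply: cS => B [e /= e0 eB].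
  have [r Sr re] := sup_adherent e0 supS.
  exists r; split => //; apply: eB => /=.
  by rewrite ger0_norm ?subr_ge0 ?sup_upper_bound//; lra.
apply: (@xgetPex _ 0 (S `&` ubound S)); exists (sup S); split => //.
exact: sup_upper_bound.
Qed.

End Max0.

(** * Slope bounds *)

Section Method.
Context {R : realType} {n : nat}.
Variables (Omega : set 'rV[R]_n) (A : 'rV[R]_n -> 'rV[R]_n -> set 'rV[R]_n).
Hypothesis A_method : is_method Omega A.

Lemma method_zero x g : Omega x -> A x g 0 -> pinorm Omega x g = 0.
Proof.
move=> Ox A0; have [_ _ _ h] := A_method g Ox.
by apply/eqP/negP => /negP /h.
Qed.

Lemma method_nonzero x g d : Omega x -> A x g d -> d != 0 ->
  0 < dot g d /\ 0 < pinorm Omega x g.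
Proof.
move=> Ox Ad d0; have [_ sub h _] := A_method g Ox.
split; first by have [[]|/= d00] := sub _ Ad => //; rewrite d00 eqxx in d0.
rewrite lt_neqAle pinorm_ge0 andbT eq_sym; apply/negP => /eqP/h A0.
by move: Ad; rewrite A0 => /= d00; rewrite d00 eqxx in d0.
Qed.

Let ratios x g := [set dot g d / (pinorm Omega x g * enorm d) | d in A x g].

Let ratios_ge0 x g : Omega x -> lbound (ratios x g) 0.
Proof.
move=> Ox _ [d Ad <-]; have [->|d0] := eqVneq d 0; first by rewrite dot0r mul0r.
have [gd pi0] := method_nonzero Ox Ad d0.
by rewrite divr_ge0 ?(ltW gd)// mulr_ge0 ?(ltW pi0)// enorm_ge0.
Qed.

Lemma DSB_ge0 x g : Omega x -> 0 <= DSB A Omega x g.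
Proof.
move=> Ox; rewrite /DSB; case: ifP => // _; apply: lb_le_inf; last exact: ratios_ge0.
have [[d Ad] _ _ _] := A_method g Ox.
by exists (dot g d / (pinorm Omega x g * enorm d)), d.
Qed.

Lemma SB_le x g d : Omega x -> A x g d -> d != 0 ->
  SB A Omega * pinorm Omega x g <= dot g d / enorm d.
Proof.
move=> Ox Ad d0; have [gd pi0] := method_nonzero Ox Ad d0.
rewrite -ler_pdivlMr// -mulrA -invfM [enorm d * _]mulrC.
apply: (@le_trans _ _ (DSB A Omega x g)).
  apply: ge_inf; first by exists 0 => _ [y [h [Oy ->]]]; exact: DSB_ge0.
  by exists x, g.
rewrite /DSB gt_eqF//=; apply: ge_inf; first by exists 0; exact: ratios_ge0.
by exists d.
Qed.

End Method.

Section Ball.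
Context {R : realType} {n : nat}.
Implicit Types (c y v : 'rV[R]_n) (r t : R).

Lemma ecball_segment c r y v t : ecball c r y -> ecball c r (y + v) ->
  0 <= t <= 1 -> ecball c r (y + t *: v).
Proof.
rewrite /ecball /= => h0 h1 /andP[t0 t1].
have -> : y + t *: v - c = (1 - t) *: (y - c) + t *: (y + v - c).
  by apply/rowP => i; rewrite !mxE; ring.
rewrite (le_trans (enormD _ _))// !enormZ !ger0_norm ?subr_ge0//.
have -> : r = (1 - t) * r + t * r by ring.
by rewrite lerD// ler_wpM2l// subr_ge0.
Qed.

End Ball.

(** * The SSC procedure *)

Section SSCrun.
Context {R : realType} {n : nat}.
Variables (Omega : set 'rV[R]_n) (f : 'rV[R]_n -> R) (L : R).
Hypotheses (cvxO : convex_set Omega) (L0 : 0 < L).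
Hypothesis df : forall x, Omega x -> differentiable f x.
Hypothesis lip : forall x y, Omega x -> Omega y ->
  enorm (gradient f x - gradient f y) <= L * enorm (x - y).
Variables (A : 'rV[R]_n -> 'rV[R]_n -> set 'rV[R]_n).
Hypothesis A_method : is_method Omega A.
Variables (xb g : 'rV[R]_n).
Hypotheses (Oxb : Omega xb) (gE : g = - gradient f xb).
Implicit Types (y v : 'rV[R]_n).

(** The closed ball with diameter from [xb] to [xb + g / L]. *)
Let ball1 y := L * dot (y - xb) (y - xb) <= dot g (y - xb).

Let ball1P y :
  ecball (xb + (2 * L)^-1 *: g) (enorm g / (2 * L)) y <-> ball1 y.
Proof.
rewrite /ecball /ball1 /=; set w := y - xb.
have -> : y - (xb + (2 * L)^-1 *: g) = w - (2 * L)^-1 *: g.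
  by rewrite opprD addrA.
clearbody w.
have L2 : 0 < 2 * L by rewrite mulr_gt0.
rewrite -ler_sqr ?nnegrE ?divr_ge0 ?enorm_ge0 ?(ltW L2)//.
rewrite expr_div_n !sqr_enorm !(dotBl, dotBr, dotZl, dotZr) (dotC w g).
move: (dot w w) (dot g w) (dot g g) => p q r.
have -> : r / (2 * L) ^+ 2 = (2 * L)^-1 * ((2 * L)^-1 * r).
  by field; rewrite gt_eqF.
have -> : (p - (2 * L)^-1 * q - ((2 * L)^-1 * q - (2 * L)^-1 * ((2 * L)^-1 * r)) <= 
  (2 * L)^-1 * ((2 * L)^-1 * r)) = (p <= (2 * L)^-1 * q * 2).
  by apply/idP/idP; lra.
have -> : (2 * L)^-1 * q * 2 = L^-1 * q by field; rewrite gt_eqF.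
by rewrite ler_pdivlMl.
Qed.

(** The first ball consists of the points where the quadratic upper bound given
    by the descent lemma is at most [f xb - L / 2 |y - xb|^2]. *)
Lemma ball_descent y : Omega y -> ball1 y ->
  f y <= f xb - L / 2 * enorm (y - xb) ^+ 2.
Proof.
move=> Oy; rewrite /ball1 -sqr_enorm => by1.
have := descent_lemma cvxO df lip Oxb Oy.
have -> : dot (gradient f xb) (y - xb) = - dot g (y - xb).
  by rewrite gE dotNl opprK.
lra.
Qed.

Let regionP v y : ssc_region L xb g v y <->
  ball1 y /\ L * enorm (y - xb) <= dot g v / enorm v.
Proof.
have E : ecball xb (dot g (hat v) / L) y <-> L * enorm (y - xb) <= dot g v / enorm v.
  by rewrite /ecball /hat /= dotZr ler_pdivlMr// mulrC [_^-1 * _]mulrC.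
by split=> [[/ball1P ? /E ?]|[/ball1P ? /E ?]].
Qed.

Let region_segment v y u t : ssc_region L xb g v y ->
  ssc_region L xb g v (y + u) -> 0 <= t <= 1 -> ssc_region L xb g v (y + t *: u).
Proof.
by move=> [h1 h2] [h3 h4] t01; split; apply: ecball_segment.
Qed.

Let beta_max y v : v != 0 -> ssc_region L xb g v y ->
  [/\ 0 <= ssc_beta L xb g y v,
      ssc_region L xb g v (y + ssc_beta L xb g y v *: v) &
      forall c, 0 <= c -> ssc_region L xb g v (y + c *: v) ->
        c <= ssc_beta L xb g y v].
Proof.
move=> v0 ry; rewrite /ssc_beta; case: asboolP => // _.
set B := [set beta | _].
have v_gt0 := enorm_gt0 v0.
have [| | |[b0 rb] ub] := @max0P _ B.
- by exists 0; rewrite /B /= scale0r addr0.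
- exists ((dot g v / enorm v / L + enorm (y - xb)) / enorm v) => c [c0 /regionP[_ h]].
  rewrite ler_pdivlMr// -[c]ger0_norm// -enormZ.
  have -> : c *: v = (y + c *: v - xb) - (y - xb).
    by apply/rowP => i; rewrite !mxE; ring.
  by rewrite (le_trans (enormB _ _))// lerD2r ler_pdivlMr// mulrC.
- have ball_closed c r : closed [set beta : R | ecball c r (y + beta *: v)].
    apply: (@preimage_closed _ _ (fun beta : R => enorm (y + beta *: v - c))
      [set s | s <= r]); last exact: closed_le.
    move=> t _; apply: (enorm_cvg (F := nbhs t) (g := fun s : R => y + s *: v - c)).
    apply: cvgB; last exact: cvg_cst.
    apply: cvgD; first exact: cvg_cst.
    by apply: cvgZr_tmp; exact: cvg_id.
  rewrite (_ : B = [set beta | 0 <= beta] `&`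
    ([set beta | ecball (xb + (2 * L)^-1 *: g) (enorm g / (2 * L)) (y + beta *: v)]
     `&` [set beta | ecball xb (dot g (hat v) / L) (y + beta *: v)])).
    apply: closedI; first exact: closed_ge.
    exact: closedI.
  by [].
- by split => // c c0 rc; apply: ub.
Qed.

Variables (d : nat -> 'rV[R]_n) (am : nat -> R).
Hypothesis adm : ssc_admissible L xb g d am Omega A.

Local Notation y_ := (ssc_y L xb g d am).
Local Notation al := (ssc_alpha L xb g d am).
Local Notation reaches := (ssc_reaches L xb g d am).
Local Notation stops := (ssc_stops L xb g d am).
Local Notation beta j := (ssc_beta L xb g (y_ j) (d j)).

Let yS j : y_ j.+1 = y_ j + al j *: d j. Proof. by []. Qed.

(** Outside the region [beta] is 0, hence so is the step. *)
Let outside j : d j != 0 -> reaches j -> ~ ssc_region L xb g (d j) (y_ j) ->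
  al j = 0.
Proof.
move=> dj0 rj nr; rewrite /ssc_alpha /ssc_step /ssc_beta; case: asboolP => // _.
by have [_ /(_ dj0)[am0 _]] := adm rj; rewrite min_r// ltW.
Qed.

Let al_ge0 j : d j != 0 -> reaches j -> 0 <= al j.
Proof.
move=> dj0 rj; have [ry|nry] := pselect (ssc_region L xb g (d j) (y_ j)).
  have [b0 _ _] := beta_max dj0 ry.
  have [_ /(_ dj0)[am0 _]] := adm rj.
  by rewrite /ssc_alpha /ssc_step le_min b0 ltW.
by rewrite outside.
Qed.

(** The segment from [y_ j] to [y_ j.+1] is contained in the region, by
    convexity, and there the slope along [d j] is nonpositive. *)
Let step_decrease j : reaches j -> Omega (y_ j) -> ball1 (y_ j) ->
  [/\ Omega (y_ j.+1), ball1 (y_ j.+1) & f (y_ j.+1) <= f (y_ j)].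
Proof.
move=> rj Oy by1; rewrite yS.
have [->|dj0] := eqVneq (d j) 0; first by rewrite scaler0 addr0.
have [ry|nry] := pselect (ssc_region L xb g (d j) (y_ j)); last first.
  by rewrite outside// scale0r addr0.
have [b0 rb bmax] := beta_max dj0 ry.
have [_ /(_ dj0)[am0 amO]] := adm rj.
have a0 := al_ge0 dj0 rj.
have [ab aam] : al j <= beta j /\ al j <= am j.
  by rewrite /ssc_alpha /ssc_step !ge_min !lexx orbT.
have ra c : 0 <= c <= al j -> ssc_region L xb g (d j) (y_ j + c *: d j).
  move=> /andP[c0 ca]; have [ab0|ab0] := eqVneq (beta j) 0.
    have -> : c = 0 by apply/eqP; rewrite eq_le c0 -ab0 (le_trans ca).
    by rewrite scale0r addr0.
  have bp : 0 < beta j by rewrite lt_neqAle eq_sym ab0.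
  have -> : c *: d j = (c / beta j) *: (beta j *: d j) by rewrite scalerA divfK.
  apply: region_segment => //.
    by rewrite divr_ge0//= ler_pdivrMr// mul1r (le_trans ca).
split.
- by apply: amO; rewrite a0.
- by have /regionP[] := ra (al j) (introT andP (conj a0 (lexx _))).
- apply: (decrease_along df lip Oxb gE a0) => s /andP[s0 s1].
  have sa : 0 <= s * al j <= al j by rewrite mulr_ge0//= ler_piMl.
  rewrite scalerA; split.
    by apply: amO; have /andP[-> h] := sa; exact: le_trans aam.
  have /regionP[_] := ra _ sa; rewrite ler_pdivlMr//; exact: enorm_gt0.
Qed.

Let reachesS i j : (i <= j)%N -> reaches j -> reaches i.
Proof. by move=> ij rj k ki; apply: rj; exact: leq_trans ij. Qed.

Let run_in j : reaches j -> Omega (y_ j) /\ ball1 (y_ j).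
Proof.
elim: j => [_|j IH rj]; first by rewrite /ball1 /= subrr !dot0r mulr0.
have rj' := reachesS (leqnSn j) rj; have [Oy b1] := IH rj'.
by have [] := step_decrease rj' Oy b1.
Qed.

Let run_decrease i j : (i <= j)%N -> reaches j -> f (y_ j.+1) <= f (y_ i).
Proof.
elim: j => [|j IH].
  rewrite leqn0 => /eqP -> r0; have [Oy b1] := run_in r0.
  by have [] := step_decrease r0 Oy b1.
move=> ij rj; have [Oy b1] := run_in rj.
have [_ _ h] := step_decrease rj Oy b1.
move: ij; rewrite leq_eqVlt => /orP[/eqP -> //|]; rewrite ltnS => ij.
exact: le_trans h (IH ij (reachesS (leqnSn j) rj)).
Qed.

(** The half-line from [xb] in a direction [v] of positive slope leaves both
    balls at the same positive parameter [dot g v / (L |v|^2)]. *)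
Let al0_gt0 : d 0%N != 0 -> 0 < al 0%N.
Proof.
move=> d0; have r0 : reaches 0 by [].
have [A0 /(_ d0)[am0 _]] := adm r0.
have [gd _] := method_nonzero A_method Oxb A0 d0.
have ed := enorm_gt0 d0.
have rc c : 0 <= c -> L * c * enorm (d 0%N) ^+ 2 <= dot g (d 0%N) ->
    ssc_region L xb g (d 0%N) (xb + c *: d 0%N).
  move=> c0 h; apply/regionP; rewrite /ball1 addrAC subrr add0r enormZ ger0_norm//; split.
    by rewrite dotZl !dotZr -sqr_enorm mulrCA ler_wpM2l//; lra.
  by rewrite ler_pdivlMr//; lra.
have ry : ssc_region L xb g (d 0%N) (y_ 0%N).
  rewrite -[y_ 0%N]addr0 -(scale0r (d 0%N)).
  by apply: rc; rewrite ?mulr0 ?mul0r// ltW.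
have [_ _ bmax] := beta_max d0 ry.
have c0 : 0 < dot g (d 0%N) / (L * enorm (d 0%N) ^+ 2).
  by rewrite divr_gt0// mulr_gt0// exprn_gt0.
have := bmax _ (ltW c0) (rc _ (ltW c0) _) => hb.
rewrite /ssc_alpha /ssc_step lt_min am0 /=; apply: lt_le_trans c0 (hb _).
rewrite le_eqVlt; apply/orP; left; apply/eqP; field.
by rewrite !gt_eqF.
Qed.

(** The displacement is at most as long as the path, so that a lower bound on
    all the slopes of the path is one on the slope of the displacement. *)
Let path_slope c j : reaches j ->
  (forall i, (i <= j)%N -> d i != 0 /\ c * enorm (d i) < dot g (d i)) -> 0 <= c ->
  c * enorm (y_ j.+1 - xb) < dot g (y_ j.+1 - xb).
Proof.
move=> + + c0; elim: j => [_ /(_ 0%N (leqnn _))[d0 h]|j IH rj h].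
  have a0 := al0_gt0 d0.
  rewrite yS /= addrAC subrr add0r enormZ ger0_norm ?(ltW a0)// dotZr.
  by rewrite mulrCA ltr_pM2l.
have [dj hj] := h _ (leqnn j.+1).
have a0 := al_ge0 dj rj.
have := IH (reachesS (leqnSn j) rj) (fun i ij => h i (leqW ij)) => lt1.
rewrite (yS j.+1) [y_ j.+1 + _ - xb]addrAC dotDr dotZr.
have := ler_wpM2l c0 (enormD (y_ j.+1 - xb) (al j.+1 *: d j.+1)).
rewrite enormZ ger0_norm//.
have := ler_wpM2l a0 (ltW hj); lra.
Qed.

(** If all the slopes exceeded [L |z - xb|], where [z] is the exit point, then
    [z] would be interior to both balls, to the first one by [path_slope], and a
    longer last step would have been possible. *)
Let exit_slope T : reaches T -> d T != 0 -> ssc_region L xb g (d T) (y_ T) ->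
  al T = beta T ->
  exists j, (j <= T)%N /\ dot g (d j) <= L * enorm (y_ T.+1 - xb) * enorm (d j).
Proof.
move=> rT dT0 ry aE; set z := y_ T.+1; apply: contrapT => /forallNP no.
have di i : (i <= T)%N -> d i != 0.
  rewrite leq_eqVlt => /orP[/eqP ->//|iT]; apply/eqP => di0.
  by apply: (rT i iT); exact: Or31.
pose w := z - xb; pose c := L * enorm w.
have c0 : 0 <= c by rewrite mulr_ge0 ?enorm_ge0// ltW.
have hs i : (i <= T)%N -> c * enorm (d i) < dot g (d i).
  by move=> iT; rewrite ltNge; apply/negP => h; apply: (no i).
have h1 := path_slope rT (fun i iT => conj (di i iT) (hs i iT)) c0.
have h2 := hs _ (leqnn T).
have [_ _ bmax] := beta_max dT0 ry.
have ed := enorm_gt0 dT0.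
rewrite -/z -/w in h1.
pose s1 := dot g w - c * enorm w; pose s2 := dot g (d T) - c * enorm (d T).
have s1p : 0 < s1 by rewrite subr_gt0.
have s2p : 0 < s2 by rewrite subr_gt0.
(* A step longer by e is possible as soon as e <= 1 and e K <= s1, s2 *)
pose K := L * (2 * enorm w * enorm (d T) + enorm (d T) ^+ 2) + L * enorm (d T) ^+ 2.
have K0 : 0 < K.
  have ? := exprn_gt0 2 ed.
  rewrite ltr_wpDl ?mulr_ge0 ?addr_ge0 ?mulr_ge0 ?enorm_ge0 ?sqr_ge0 ?mulr_gt0// ltW//.
pose e := Num.min 1 (Num.min (s1 / K) (s2 / K)).
have e0 : 0 < e by rewrite /e !lt_min ltr01 !divr_gt0.
have e1 : e <= 1 by rewrite /e ge_min lexx.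
have es1 : e * K <= s1 by rewrite -ler_pdivlMr// /e !ge_min lexx !orbT.
have es2 : e * K <= s2 by rewrite -ler_pdivlMr// /e !ge_min lexx !orbT.
suff : ssc_region L xb g (d T) (y_ T + (al T + e) *: d T).
  move=> /(bmax _ (addr_ge0 (al_ge0 dT0 rT) (ltW e0))).
  by rewrite aE; apply/negP; rewrite -ltNge ltrDl.
have E : y_ T + (al T + e) *: d T - xb = w + e *: d T.
  by rewrite scalerDl addrA -yS -/z addrAC.
apply/regionP; rewrite /ball1 E; clearbody w; split.
  rewrite !(dotDl, dotDr, dotZl, dotZr) (dotC (d T) w) -!sqr_enorm.
  have [gd _] := method_nonzero A_method (run_in rT).1 (adm rT).1 dT0.
  have p1 := ler_wpM2l (ltW (mulr_gt0 L0 e0)) (dot_le_enorm w (d T)).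
  have p2 := ler_wpM2l (mulr_ge0 (ltW (mulr_gt0 L0 e0)) (sqr_ge0 (enorm (d T)))) e1.
  have p3 := mulr_gt0 e0 gd.
  have p4 := mulr_ge0 (ltW (mulr_gt0 L0 e0)) (sqr_ge0 (enorm (d T))).
  move: es1; rewrite /s1 /K /c; lra.
rewrite ler_pdivlMr//.
have p1 := ler_wpM2l (ltW L0) (enormD w (e *: d T)).
rewrite enormZ (ger0_norm (ltW e0)) in p1.
have p2 := ler_wpM2r (ltW ed) p1.
have p4 := mulr_ge0 (ltW (mulr_gt0 L0 e0)) (sqr_ge0 (enorm (d T))).
have p5 := mulr_ge0 (ltW (mulr_gt0 L0 e0)) (mulr_ge0 (enorm_ge0 w) (ltW ed)).
by move: es2; rewrite /s2 /K /c; lra.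
Qed.

(** The point [y] is the last vertex [y_ T] if the direction there is zero or
    [y_ T] is outside its region, and otherwise the vertex given by
    [exit_slope].  In all cases [y] is not farther from [xb] than [z] is, and the projection of [g]
    at [y] is at most [L / SB |z - xb|]; the change from [g] to the gradient at
    [y] costs [L |z - xb|] more. *)
Lemma ssc_estimate z : 0 < SB A Omega -> ssc_returns L xb g d am z ->
  [/\ Omega z, f z <= f xb - L / 2 * enorm (z - xb) ^+ 2 &
  exists y, [/\ Omega y, f z <= f y, f y <= f xb - L / 2 * enorm (y - xb) ^+ 2 &
    SB A Omega * pinorm Omega y (- gradient f y)
      <= L * (1 + SB A Omega) * enorm (z - xb)]].
Proof.
move=> tau0 [T [rT sT zE]].
have {zE} zE : z = y_ T.+1.
  rewrite zE yS; have [->|dT0] /= := eqVneq (d T) 0; first by rewrite scaler0 addr0.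
  by have [->|] := eqVneq (al T) 0; rewrite ?scale0r ?addr0.
have [OT bT] := run_in rT.
have [Oz bz _] := step_decrease rT OT bT.
rewrite -zE in Oz bz.
split => //; first exact: ball_descent.
suff [j [jT hj1 hj2]] : exists j, [/\ (j <= T)%N,
    enorm (y_ j - xb) <= enorm (z - xb) &
    SB A Omega * pinorm Omega (y_ j) g <= L * enorm (z - xb)].
  have [Oj bj] := run_in (reachesS jT rT).
  exists (y_ j); split => //; first by rewrite zE; exact: run_decrease.
    exact: ball_descent.
  have h1 := pinorm_lip cvxO Oj (- gradient f (y_ j)) g.
  have h2 : enorm (- gradient f (y_ j) - g) <= L * enorm (y_ j - xb).
    have -> : - g = gradient f xb by rewrite gE opprK.
    by rewrite addrC enormBC; exact: lip.
  have h3 := ler_wpM2l (ltW L0) hj1.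
  have h4 := ler_wpM2l (ltW tau0) (le_trans h1 (lerD (lexx _) (le_trans h2 h3))).
  lra.
have [dT0|dT0] := eqVneq (d T) 0.
  exists T; rewrite zE yS dT0 scaler0 addr0; split => //.
  rewrite (method_zero A_method OT) ?mulr0 ?mulr_ge0 ?enorm_ge0 ?(ltW L0)//.
  by have [] := adm rT; rewrite dT0.
have [ry|nry] := pselect (ssc_region L xb g (d T) (y_ T)); last first.
  have aT := outside dT0 rT nry.
  exists T; rewrite zE yS aT scale0r addr0; split => //.
  apply: (le_trans (SB_le A_method OT (adm rT).1 dT0)).
  by rewrite leNgt; apply/negP => /ltW h; apply/nry/regionP.
have aE : al T = beta T.
  have [/eqP|aT|//] := sT; first by rewrite (negbTE dT0).
  have [b0 _ _] := beta_max dT0 ry.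
  have [_ /(_ dT0)[am0 _]] := adm rT.
  move: aT; rewrite /ssc_alpha /ssc_step /Num.min; case: ifP => // _ am00.
  by rewrite am00 ltxx in am0.
have [j [jT hj]] := exit_slope rT dT0 ry aE; rewrite -zE in hj.
have rj := reachesS jT rT; have [Oj bj] := run_in rj.
have [dj0 ryj] : d j != 0 /\ ssc_region L xb g (d j) (y_ j).
  move: jT; rewrite leq_eqVlt => /orP[/eqP -> //|jT].
  have dj0 : d j != 0 by apply/eqP => dj0; apply: (rT j jT); exact: Or31.
  split => //; apply: contrapT => nr; apply: (rT j jT).
  by apply: Or32; exact: outside.
have ed := enorm_gt0 dj0.
have hj' : dot g (d j) / enorm (d j) <= L * enorm (z - xb) by rewrite ler_pdivrMr.
exists j; split => //.
  by have /regionP[_ /le_trans/(_ hj')] := ryj; rewrite ler_pM2l.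
exact: le_trans (SB_le A_method Oj (adm rj).1 dj0) hj'.
Qed.

End SSCrun.

(** * The potential *)

Section Potential.
Context {R : realType}.
Variables (rho : R) (phi : R -> R) (a b : R).
Hypotheses (desing : desingularizing rho phi) (a0 : 0 < a) (b0 : 0 < b).
Implicit Types r s t : R.

Let alpha t := b / Num.sqrt a * derive1 phi t.

Let alpha_gt0 s : 0 < s < rho -> 0 < alpha s.
Proof.
by move=> srho; rewrite mulr_gt0 ?divr_gt0 ?sqrtr_gt0// (desing_derive_gt0 desing).
Qed.

Let alpha_cont s : 0 < s < rho -> {for s, continuous alpha}.
Proof.
move=> srho; have [_ _ _ [_ cphi] _] := desing.
apply: continuousM; first exact: cst_continuous.
by apply: cphi; rewrite in_itv.
Qed.

Lemma alpha_sqr t : alpha t ^+ 2 = b ^+ 2 / a * derive1 phi t ^+ 2.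
Proof. by rewrite exprMn expr_div_n sqr_sqrtr// ltW. Qed.

(** A bound for the length of the rest of the trajectory, when the current value
    is [r]: [potential_step] makes it decrease by at least the length of each
    step. *)
Definition potential r :=
  b / a * phi (sigma alpha r) + 2 * Num.sqrt ((r - sigma alpha r) / a).

Let sigmaP r : 0 <= r < rho -> 0 <= sigma alpha r < rho /\ sigma alpha r <= r.
Proof.
move=> /andP[r0 rrho]; have /andP[-> sr] := sigma_bounds alpha r0.
by rewrite sr (le_lt_trans sr).
Qed.

Lemma potential_ge0 r : 0 <= r < rho -> 0 <= potential r.
Proof.
move=> rr; have [sr _] := sigmaP rr.
rewrite addr_ge0 ?mulr_ge0 ?sqrtr_ge0 ?(ltW b0) ?invr_ge0 ?(ltW a0)//.
exact: (desing_ge0 desing).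
Qed.

Lemma potential_le r : 0 <= r < rho ->
  potential r <= b / a * phi r + 2 * Num.sqrt ((r - sigma alpha r) / a).
Proof.
move=> rr; have [/andP[s0 _] sr] := sigmaP rr.
rewrite lerD2r ler_pM2l ?divr_gt0//; apply: (desing_ndecr desing) => //.
by have /andP[] := rr.
Qed.

(** Let [s] and [s'] be the images of [r] and [r'] under [sigma].  By concavity
    [phi s - phi s' >= phi'(s) (s - s')], where [phi'(s)] is bounded below by
    means of [r - s], and [s - s'] is the sum of [s - r'], which accounts for the
    left-hand root, and of [r' - s'], which accounts for the root in the
    potential of [r']. *)
Lemma potential_step r r' : 0 <= r < rho -> 0 <= r' <= sigma alpha r ->
  Num.sqrt ((r - r') / a) + potential r' <= potential r.
Proof.
move=> rr /andP[r'0 r's]; have [srho sr] := sigmaP rr.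
have r'rho : 0 <= r' < rho by rewrite r'0 (le_lt_trans r's)//; case/andP: srho.
have [s'rho s'r'] := sigmaP r'rho.
rewrite /potential.
have := sqrtr_ge0 ((r' - sigma alpha r') / a).
have := sqrtr_ge0 ((r - sigma alpha r) / a).
have := sqrtr_ge0 ((r - r') / a).
have := @sqr_sqrtr _ ((r' - sigma alpha r') / a).
have := @sqr_sqrtr _ ((r - sigma alpha r) / a).
have := @sqr_sqrtr _ ((r - r') / a).
have [s0|s0] := eqVneq (sigma alpha r) 0.
  have r'E : r' = 0 by apply/eqP; rewrite eq_le r'0 -s0 r's.
  have s'E : sigma alpha r' = 0.
    by apply/eqP; rewrite eq_le (andP s'rho).1 (le_trans s'r')// r'E.
  by rewrite s0 s'E r'E !subr0 mul0r sqrtr0; lra.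
set s := sigma alpha r in srho sr r's s0 *.
set s' := sigma alpha r' in s'rho s'r' *.
have {}s0 : 0 < s by rewrite lt_neqAle eq_sym s0; case/andP: srho.
have srho' : 0 < s < rho by rewrite s0; case/andP: srho.
have := sigma_spec alpha_gt0 (andP rr).2 s0; rewrite -/s alpha_sqr.
have := desing_tangent desing srho' s'rho.
have := desing_derive_gt0 desing srho'.
move: (Num.sqrt ((r - r') / a)) (Num.sqrt ((r - s) / a)).
move: (Num.sqrt ((r' - s') / a)) => p' D p.
move=> dphi0 tgt spec.
rewrite !divr_ge0 ?subr_ge0 ?(ltW a0)//; last exact: le_trans sr.
move=> /(_ isT) D2 /(_ isT) p2 /(_ isT) p'2 D0 p0 p'0.
(* In terms of kappa the inequality alpha(s)^2 (r - s) >= 1 is kappa a p >= 1 *)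
pose kappa := b / a * derive1 phi s.
have kappa0 : 0 < kappa by rewrite mulr_gt0 ?divr_gt0.
have rsE : r - s = a * p ^+ 2 by rewrite p2 mulrC divfK ?gt_eqF.
have r's'E : r' - s' = a * p' ^+ 2 by rewrite p'2 mulrC divfK ?gt_eqF.
have rr'E : r - r' = a * D ^+ 2 by rewrite D2 mulrC divfK ?gt_eqF.
have kp : 1 <= kappa * a * p.
  have kp0 : 0 <= kappa * a * p by rewrite mulr_ge0// mulr_ge0 ?ltW.
  rewrite -(@ler_pXn2r _ 2) ?nnegrE// expr1n (le_trans spec)// rsE.
  rewrite le_eqVlt; apply/orP; left; apply/eqP; rewrite /kappa; field.
  by rewrite gt_eqF.
have ppos : 0 < p.
  rewrite lt_neqAle p0 andbT eq_sym.
  by apply: contraTneq kp => ->; rewrite mulr0 ler10.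
have h1 : kappa * (s - s') <= b / a * phi s - b / a * phi s'.
  by rewrite -mulrBr /kappa -mulrA ler_pM2l ?divr_gt0.
have h2 : (s - r' + a * p' ^+ 2) <= kappa * (s - s') * (a * p).
  rewrite -r's'E addrA subrK; have : 0 <= s - s' by lra.
  by move=> ss'; have := ler_wpM2l ss' kp; lra.
have h3 : kappa * (s - s') * p <= (b / a * phi s - b / a * phi s') * p.
  by rewrite ler_pM2r.
have h4 := ler_wpM2l (ltW a0) h3.
suff : (D + (b / a * phi s' + 2 * p')) * p * a <= (b / a * phi s + 2 * p) * p * a.
  by rewrite ler_pM2r// ler_pM2r.
(* D p <= (D^2 + p^2) / 2 with a D^2 = a p^2 + (s - r'), and 2 p' p <= p^2 + p'^2:
   the second one is the reason for the factor 2 in the potential *)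
have h5 := mulr_ge0 (ltW a0) (sqr_ge0 (D - p)).
have h6 := mulr_ge0 (ltW a0) (sqr_ge0 (p' - p)).
nra.
Qed.

(** The vertices of the SSC path may have values [t] above [sigma r], out of reach
    of [potential_step]; there the root is at most the one in the potential. *)
Lemma potential_dist r t : 0 <= r < rho -> 0 <= t <= r ->
  Num.sqrt ((r - t) / a) <= potential r.
Proof.
move=> rr /andP[t0 tr]; have [srho sr] := sigmaP rr.
have [ts|/ltW st] := leP t (sigma alpha r).
  have trho : 0 <= t < rho by rewrite t0 (le_lt_trans tr)//; case/andP: rr.
  have := @potential_step r t rr; rewrite t0 ts => /(_ isT).
  have := potential_ge0 trho; lra.
have : Num.sqrt ((r - t) / a) <= Num.sqrt ((r - sigma alpha r) / a).
  by rewrite ler_wsqrtr// ler_pM2r ?invr_gt0// lerB.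
have := sqrtr_ge0 ((r - sigma alpha r) / a).
have : 0 <= b / a * phi (sigma alpha r).
  by rewrite mulr_ge0 ?(desing_ge0 desing srho)// divr_ge0 ?ltW.
rewrite /potential; lra.
Qed.

(** Here [t] and [p] are the value and the projected gradient at a vertex of the
    SSC path where KL holds, while [r'] is the next value.  As [derive1 phi] is
    nonincreasing, the KL inequality remains true with [r'] in place of [t]. *)
Lemma KL_le_sigma r r' t (p w : R) : 0 <= r' -> r' <= t -> t <= r -> r < rho ->
  0 <= p -> (0 < t -> 1 <= derive1 phi t * p) -> p <= b * w ->
  a * w ^+ 2 <= r - r' -> r' <= sigma alpha r.
Proof.
move=> r'0 r't tr rrho p0 kl pbw aw.
have r0 := le_trans r'0 (le_trans r't tr).
move: r'0; rewrite le_eqVlt => /orP[/eqP <-|r'0].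
  by have /andP[] := sigma_bounds alpha r0.
apply: (le_sigma alpha_gt0 alpha_cont) => //; first exact: le_trans tr.
have t0 := lt_le_trans r'0 r't; have trho := le_lt_trans tr rrho.
have d0 : 0 < derive1 phi r'.
  by apply: (desing_derive_gt0 desing); rewrite r'0 (le_lt_trans r't).
have h : 1 <= derive1 phi r' * (b * w).
  apply: (le_trans (kl t0)); apply: (@le_trans _ _ (derive1 phi r' * p)).
    by rewrite ler_wpM2r// (desing_derive_nincr desing).
  by rewrite ler_pM2l.
rewrite alpha_sqr; apply: (@le_trans _ _ ((derive1 phi r' * (b * w)) ^+ 2)).
  by rewrite exprn_ege1.
have -> : (derive1 phi r' * (b * w)) ^+ 2 =
    b ^+ 2 / a * derive1 phi r' ^+ 2 * (a * w ^+ 2) by field; rewrite gt_eqF.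
by rewrite ler_wpM2l// mulr_ge0 ?sqr_ge0// divr_ge0 ?sqr_ge0// ltW.
Qed.

Lemma desing_sigma_homo s t : 0 <= s -> s <= t -> t < rho ->
  sigma alpha s <= sigma alpha t.
Proof. exact: (sigma_homo alpha_gt0 alpha_cont). Qed.

End Potential.

(** * Sequences of finite length *)

Section Telescoping.
Context {R : realType} {n : nat}.
Variables (x : nat -> 'rV[R]_n) (e : nat -> R).
Hypothesis e_ge0 : forall k, 0 <= e k.
Hypothesis step_le : forall k, enorm (x k - x k.+1) <= e k - e k.+1.

Let e_nincr : nonincreasing_seq e.
Proof.
apply/nonincreasing_seqP => k; rewrite -subr_ge0.
exact: le_trans (enorm_ge0 _) (step_le k).
Qed.

Let e_cvg : cvgn e.
Proof.
apply: nonincreasing_is_cvgn => //; by exists 0 => _ [k _ <-].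
Qed.

Let sum_le (k m : nat) : (k <= m)%N ->
  \sum_(k <= i < m) enorm (x i - x i.+1) <= e k - e m.
Proof.
elim: m => [|m IH]; first by rewrite leqn0 => /eqP ->; rewrite big_geq// subrr.
rewrite leq_eqVlt => /orP[/eqP <-|]; first by rewrite big_geq// subrr.
rewrite ltnS => km; rewrite big_nat_recr//=.
have := IH km; have := step_le m; lra.
Qed.

Lemma telescoping_cvg0 : e k - e k.+1 @[k --> \oo] --> (0 : R).
Proof.
rewrite -(subrr (lim (e @ \oo))); apply: cvgB; first exact: e_cvg.
by rewrite (cvg_shiftS e); exact: e_cvg.
Qed.

(** The distance from [x k] to a later [x m] is at most [e k - e m], and [e] is a
    Cauchy sequence since it is monotone and bounded. *)
Lemma telescoping_cvg : exists xt : 'rV[R]_n, x @ \oo --> xt /\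
  forall k, ((enorm (x k - xt))%:E <= \sum_(k <= i <oo) (enorm (x i - x i.+1))%:E
             <= (e k)%:E)%E.
Proof.
have : cvg (x @ \oo).
  apply/cauchy_cvgP/cauchy_exP => eps eps0.
  have [N _ /(_ N (leqnn N))/= eN] : \forall k \near \oo, e k < lim (e @ \oo) + eps.
    by apply: (cvgr_lt _ e_cvg); rewrite ltrDl.
  exists (x N); exists N => // m /= Nm.
  rewrite -ball_normE /= (le_lt_trans (norm_le_enorm _))//.
  apply: (le_lt_trans (enorm_sum x Nm)); apply: (le_lt_trans (sum_le Nm)).
  have := nonincreasing_cvgn_ge e_nincr e_cvg m; lra.
move=> /cvg_ex[xt xcvg]; exists xt; split => // k.
have sum_ge0 i : (0 <= (enorm (x i - x i.+1))%:E)%E by rewrite lee_fin enorm_ge0.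
apply/andP; split; last first.
  apply: lime_le; first by apply: is_cvg_nneseries => *.
  exists k => // m /= km; rewrite sumEFin lee_fin (le_trans (sum_le km))//.
  by rewrite gerBl.
have dcvg : (enorm (x k - x m))%:E @[m --> \oo] --> (enorm (x k - xt))%:E.
  apply: cvg_EFin; first by near=> m.
  apply: enorm_cvg; apply: cvgB => //; exact: cvg_cst.
apply: (cvge_to_le dcvg); exists k => // m /= km.
apply: (le_trans _ (nneseries_lim_ge m (fun i _ _ => sum_ge0 i))).
by rewrite sumEFin lee_fin; exact: enorm_sum.
Unshelve. all: by end_near. Qed.

End Telescoping.

(** * Stationarity of limits *)

Section Stationary.
Context {R : realType} {n : nat}.
Variables (Omega : set 'rV[R]_n) (f : 'rV[R]_n -> R) (L : R).
Hypotheses (cvxO : convex_set Omega) (compO : compact Omega).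
Hypothesis lip : forall x y, Omega x -> Omega y ->
  enorm (gradient f x - gradient f y) <= L * enorm (x - y).

(** Although [pinorm] is not continuous in its base point, its zeros are
    described by the inequalities [<g, z - y> <= 0] for all [z], which pass to
    the limit. *)
Lemma stationary_limit (y : nat -> 'rV[R]_n) (xt : 'rV[R]_n) :
  (forall k, Omega (y k)) -> y @ \oo --> xt ->
  pinorm Omega (y k) (- gradient f (y k)) @[k --> \oo] --> (0 : R) ->
  stationary Omega f xt.
Proof.
move=> Oy ycvg pcvg.
have Oxt : Omega xt.
  apply: (closed_cvg _ _ _ _ ycvg).
    by apply: compact_closed compO; exact: norm_hausdorff.
  exact: nearW.
have ycvg0 : enorm (y k - xt) @[k --> \oo] --> (0 : R).
  rewrite -(@enorm0 R n) -(subrr xt); apply: enorm_cvg.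
  by apply: cvgB => //; exact: cvg_cst.
have gcvg : gradient f (y k) @[k --> \oo] --> gradient f xt.
  apply: enorm0_cvg.
  apply: (squeeze_cvgr (f := fun=> 0) (h := fun k => L * enorm (y k - xt))).
  - by apply: nearW => k; rewrite enorm_ge0 lip.
  - exact: cvg_cst.
  - by rewrite -(mulr0 L); apply: cvgM => //; exact: cvg_cst.
split => //; apply: pinorm_eq0 => // z Oz.
have lhs : dot (- gradient f (y k)) (z - y k) @[k --> \oo] -->
    dot (- gradient f xt) (z - xt).
  by apply: dot_cvg; [exact: cvgN|apply: cvgB => //; exact: cvg_cst].
have rhs : pinorm Omega (y k) (- gradient f (y k)) * enorm (z - y k)
    @[k --> \oo] --> 0 * enorm (z - xt).
  apply: cvgM => //; apply: enorm_cvg; apply: cvgB => //; exact: cvg_cst.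
rewrite -(mul0r (enorm (z - xt))).
apply: (ler_cvg_to lhs rhs); apply: nearW => k.
exact: dot_le_pinorm.
Qed.

End Stationary.

(** * Convergence of the first-order method *)

Theorem corollary5p2 (R : realType) (n : nat)
  (Omega : set 'rV[R]_n) (f : 'rV[R]_n -> R) (L : R)
  (Omega_nonempty : Omega !=set0) (Omega_compact : compact Omega)
  (Omega_convex : convex_set Omega)
  (L_gt0 : 0 < L) (f_C1 : C1_on Omega f)
  (grad_lipschitz : forall x y, Omega x -> Omega y ->
     enorm (gradient f x - gradient f y) <= L * enorm (x - y))
  (xs : 'rV[R]_n) (delta eta : R) (phi : R -> R)
  (xs_in : Omega xs) (f_KL : KL_inequality Omega f xs delta eta phi)
  (A : 'rV[R]_n -> 'rV[R]_n -> set 'rV[R]_n) (A_method : is_method Omega A)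
  (rule : ssc_rule R n) (rule_ssc : is_ssc_rule L Omega A rule)
  (ssc_finite : ssc_always_terminates L Omega rule)
  (tau : R) (SB_tau : SB A Omega = tau) (tau_gt0 : 0 < tau)
  (x : nat -> 'rV[R]_n) (x_gen : generated_by_ssc L Omega f rule x)
  (a b : R) (alpha : R -> R)
  (a_def : a = L / 2) (b_def : b = L * (1 + tau) / tau)
  (alpha_def : alpha = fun t => b / Num.sqrt a * derive1 phi t)
  (h_i : f xs <= f (x 0%N) < eta)
  (h_ii : forall k, eball xs delta (x k) -> f (x k.+1) >= f xs)
  (h_iii : b / a * phi (f (x 0%N) - f xs)
           + 2 * Num.sqrt ((f (x 0%N) - f xs - sigma alpha (f (x 0%N) - f xs))
                           / a)
           + enorm (x 0%N - xs) < delta) :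
  exists xt : 'rV[R]_n,
    [/\ x @ \oo --> xt,
        stationary Omega f xt &
        forall k,
          f (x k) - f xs <= iter k (sigma alpha) (f (x 0%N) - f xs) /\
          ((enorm (x k - xt))%:E
             <= \sum_(k <= i <oo) (enorm (x i - x i.+1))%:E
             <= (b / a * phi (f (x k) - f xs)
                 + 2 * Num.sqrt ((f (x k) - f xs
                                  - sigma alpha (f (x k) - f xs)) / a))%:E)%E].
Proof.
have [df _] := f_C1; have [Ox0 xstep] := x_gen.
have [delta0 xseta desing kl] := f_KL.
have a0 : 0 < a by rewrite a_def divr_gt0.
have b0 : 0 < b by rewrite b_def divr_gt0 ?mulr_gt0 ?addr_gt0.
have Ox k : Omega (x k) by case: k => // k; have [] := xstep k.
pose r k := f (x k) - f xs; pose rho := eta - f xs.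
pose P := potential phi a b.
have r0rho : 0 <= r 0%N < rho.
  by rewrite subr_ge0 (andP h_i).1 ltrD2r (andP h_i).2.
have dist_le (v : 'rV[R]_n) (s : R) : a * enorm v ^+ 2 <= s ->
    enorm v <= Num.sqrt (s / a).
  move=> h; rewrite -[enorm v]ger0_norm ?enorm_ge0// -sqrtr_sqr ler_wsqrtr//.
  by rewrite ler_pdivlMr// mulrC.
(* [y] is the vertex of the SSC path given by [ssc_estimate] *)
have iteration k : exists y, [/\ Omega y, f (x k.+1) <= f y <= f (x k),
    enorm (y - x k) <= Num.sqrt ((r k - (f y - f xs)) / a),
    enorm (x k - x k.+1) <= Num.sqrt ((r k - r k.+1) / a) &
    pinorm Omega y (- gradient f y) <= b * Num.sqrt ((r k - r k.+1) / a)].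
  have [_ _ [z [c rc cret]]] := xstep k.
  rewrite le_min => /andP[fz fx].
  have SB0 : 0 < SB A Omega by rewrite SB_tau.
  have [_ fz2 [y [Oy zy fy]]] := ssc_estimate Omega_convex L_gt0 df
    grad_lipschitz A_method (Ox k) erefl (rule_ssc _ _ _ (Ox k) rc) SB0 cret.
  rewrite SB_tau => piy; rewrite -a_def in fx fz2 fy.
  exists y; split => //.
  - rewrite (le_trans fz)//= (le_trans fy)// gerBl mulr_ge0 ?sqr_ge0//.
    exact: ltW.
  - by apply: dist_le; rewrite /r; lra.
  - by rewrite enormBC; apply: dist_le; rewrite /r; lra.
  - apply: (@le_trans _ _ (b * enorm (z - x k))).
      by rewrite b_def mulrAC ler_pdivlMr// mulrC.
    by rewrite ler_pM2l//; apply: dist_le; rewrite /r; lra.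
have [y yP] := choice iteration.
have r_nincr k : r k.+1 <= r k.
  by have [_ /andP[h1 h2] _ _ _] := yP k; rewrite lerD2r (le_trans h1).
(* As [x k] is close to [xs], the vertex [y k] is in the ball where KL holds *)
have x_step k : 0 <= r k < rho -> enorm (x k - xs) + P (r k) < delta ->
    0 <= r k.+1 <= sigma alpha (r k).
  move=> rk close; have [Oy /andP[fy1 fy2] dy _ piy] := yP k.
  have Prk : 0 <= P (r k) := potential_ge0 desing a0 b0 rk.
  have rS0 : 0 <= r k.+1 by rewrite subr_ge0; apply: h_ii; rewrite /eball /=; lra.
  have yk0 : 0 <= f (y k) - f xs by move: rS0; rewrite /r; lra.
  have yle : f (y k) - f xs <= r k by rewrite lerD2r.
  have yclose : eball xs delta (y k).
    have := enorm_triangle (y k) (x k) xs.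
    have := @potential_dist _ _ _ _ _ desing a0 b0 _ (f (y k) - f xs) rk.
    by rewrite yk0 yle -/P /eball /= => /(_ isT); lra.
  rewrite rS0 alpha_def /=.
  apply: (KL_le_sigma desing a0 b0 rS0 _ yle (andP rk).2 (pinorm_ge0 _ _ _) _ piy).
  - by rewrite lerD2r.
  - rewrite subr_gt0 => fy0; apply: kl => //; rewrite fy0 /=.
    by have := (andP rk).2; rewrite /rho /r; lra.
  - rewrite sqr_sqrtr ?divr_ge0 ?subr_ge0 ?(ltW a0)//.
    by rewrite mulrC divfK ?gt_eqF.
(* The third assumption is the case k = 0, as [P r] is at most its bound there *)
have inv k : 0 <= r k < rho /\ enorm (x k - xs) + P (r k) < delta.
  elim: k => [|k [rk close]].
    split => //; have := potential_le desing a0 b0 r0rho.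
    by move: h_iii; rewrite alpha_def /P /r; lra.
  have rS := x_step _ rk close.
  split; first by rewrite (andP rS).1 (le_lt_trans (r_nincr k))// (andP rk).2.
  rewrite alpha_def in rS.
  have h1 := potential_step desing a0 b0 rk rS.
  have [_ _ _ h2 _] := yP k.
  have := enorm_triangle (x k.+1) (x k) xs; rewrite (enormBC _ (x k)).
  by move: close; rewrite /P; lra.
have P_step k : enorm (x k - x k.+1) <= P (r k) - P (r k.+1).
  have [rk close] := inv k; have rS := x_step _ rk close.
  rewrite alpha_def in rS.
  have := potential_step desing a0 b0 rk rS; have [_ _ _ h2 _] := yP k.
  rewrite /P; lra.
have P_ge0 k : 0 <= P (r k) by exact: (potential_ge0 desing a0 b0 (inv k).1).
have [xt [xcvg xsum]] := telescoping_cvg P_ge0 P_step.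
exists xt; split => //.
- have wcvg : Num.sqrt ((r k - r k.+1) / a) @[k --> \oo] --> (0 : R).
    apply: (squeeze_cvgr (f := fun=> 0) (h := fun k => P (r k) - P (r k.+1))).
    + apply: nearW => k; rewrite sqrtr_ge0/= lerBrDr.
      have [rk close] := inv k; have rS := x_step _ rk close.
      rewrite alpha_def in rS.
      exact: (potential_step desing a0 b0 rk rS).
    + exact: cvg_cst.
    + exact: telescoping_cvg0 P_ge0 P_step.
  apply: (@stationary_limit _ _ Omega f L Omega_convex Omega_compact grad_lipschitz y).
  + by move=> k; have [] := yP k.
  + suff yx : y k - x k @[k --> \oo] --> (0 : 'rV[R]_n).
      by rewrite -[xt]add0r -[y](subrK x); exact: cvgD.
    apply: enorm0_cvg; apply: (squeeze_cvgr (f := fun=> 0)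
      (h := fun k => Num.sqrt ((r k - r k.+1) / a))) => //; last exact: cvg_cst.
    apply: nearW => k; rewrite subr0 enorm_ge0/=.
    have [_ /andP[fy _] dy _ _] := yP k; apply: (le_trans dy).
    by rewrite ler_wsqrtr// ler_pM2r ?invr_gt0// lerB// lerD2r.
  + apply: (squeeze_cvgr (f := fun=> 0)
      (h := fun k => b * Num.sqrt ((r k - r k.+1) / a))).
    * by apply: nearW => k; rewrite pinorm_ge0/=; have [] := yP k.
    * exact: cvg_cst.
    * by rewrite -(mulr0 b); apply: cvgM => //; exact: cvg_cst.
- move=> k; split.
    elim: k => // k IH; rewrite iterS.
    have [rk close] := inv k; have /andP[_ h] := x_step _ rk close.
    apply: (le_trans h).
    rewrite alpha_def in IH *; apply: (desing_sigma_homo desing a0 b0 (andP rk).1 IH).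
    have /andP[_ itle] := iter_sigma_bounds
      (fun t => b / Num.sqrt a * derive1 phi t) k (andP r0rho).1.
    exact: le_lt_trans itle (andP r0rho).2.
  have /andP[-> h] := xsum k; apply: (le_trans h).
  by rewrite lee_fin alpha_def; exact: (potential_le desing a0 b0 (inv k).1).
Qed.
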